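(* Let $M$ be a smooth closed Riemannian manifold. Let $\mu$ be a Borel probability measure on $\mathrm{Lip}(M)$ satisfying: (1) for some $\alpha>0$, $\int_{\mathrm{Lip}(M)} (\log \mathfrak{L}(f))^{\alpha}\, d\mu(f)<\infty$; (2) there is no Borel probability measure $m$ on $M$ such that $f_*m=m$ for $\mu$-a.e. $f$. Then there exists a constant $C<\infty$ such that every $\mu$-stationary Borel probability measure $\nu$ on $M$ is $(C,\alpha/2)$-$\log$-Hölder.
   Context: $d$ is the Riemannian distance on $M$. $\mathrm{Homeo}(M)$ is the group of homeomorphisms of $M$ with the topology of uniform convergence; $\mathrm{Lip}(M)\subset \mathrm{Homeo}(M)$ is the set of bi-Lipschitz homeomorphisms, and for $f\in\mathrm{Lip}(M)$, $\mathfrak{L}(f)=\max\left(\sup_{x\neq y}\frac{d(f(x),f(y))}{d(x,y)},\ \sup_{x\ne y}\frac{d(f^{-1}(x),f^{-1}(y))}{d(x,y)}\right)$. For a Borel probability measure $\nu$ on $M$, $\mu*\nu=\int (f_*\nu)\,d\mu(f)$; $\nu$ is $\mu$-stationary if $\mu*\nu=\nu$. A Borel probability measure $\nu$ on $M$ is $(C,\alpha)$-$\log$-Hölder if $\nu(B_r(x))\le C|\log r|^{-\alpha}$ for every $x\in M$ and every $0<r<1$, where $B_r(x)$ is the ball of radius $r$ centered at $x$. *)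

(* Defs.v *)
From HB Require Import structures.
From mathcomp Require Import all_boot all_order all_algebra.
From mathcomp Require Import all_classical all_reals all_analysis.

Set Implicit Arguments.
Unset Strict Implicit.
Unset Printing Implicit Defensive.

Import Order.TTheory GRing.Theory Num.Theory.
Import numFieldNormedType.Exports.

Local Open Scope classical_set_scope.
Local Open Scope ring_scope.

(* The library's measurable types are pointed, hence nonempty. *)
#[short(type="pmetricType")]
HB.structure Definition PointedMetric (R : numDomainType) :=
  {M of Metric R M & Pointed M}.

Notation borelType T := (g_sigma_algebraType (@open T)).

Section smooth.
Context {R : realType} {n : nat} {W : normedModType R}.

(* f is of class C^k at the points of the open set U *)
Fixpoint Ck_on (k : nat) (U : set 'rV[R]_n) (f : 'rV[R]_n -> W) : Prop :=
  if k is k'.+1 then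
    (forall x, U x -> differentiable f x) /\ (forall v, Ck_on k' U ('D_v f))
  else forall x, U x -> {for x, continuous f}.

Definition smooth_on (U : set 'rV[R]_n) (f : 'rV[R]_n -> W) : Prop :=
  forall k, Ck_on k U f.

End smooth.

(* An n-dimensional smooth atlas without boundary. [chart i] and [chart_inv i]
   are total functions, meaningful on [chart_dom i] and on its image only;
   [chart_at] selects a chart around each point. *)
Record smoothAtlas (R : realType) (n : nat) (M : topologicalType) := SmoothAtlas {
  chart_index : Type ;
  chart_dom : chart_index -> set M ;
  chart : chart_index -> M -> 'rV[R]_n ;
  chart_inv : chart_index -> 'rV[R]_n -> M ;
  chart_at : M -> chart_index ;
  chart_at_dom : forall p, chart_dom (chart_at p) p ;
  chart_dom_open : forall i, open (chart_dom i) ;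
  chart_image_open : forall i, open (chart i @` chart_dom i) ;
  chartK : forall i p, chart_dom i p -> chart_inv i (chart i p) = p ;
  chart_continuous : forall i p, chart_dom i p -> {for p, continuous (chart i)} ;
  chart_inv_continuous : forall i p, chart_dom i p ->
    {for chart i p, continuous (chart_inv i)} ;
  transition_smooth : forall i j,
    smooth_on (chart i @` (chart_dom i `&` chart_dom j)) (chart j \o chart_inv i)
}.

Definition bilin (R : realType) (n : nat) (G : 'M[R]_n) (v w : 'rV[R]_n) : R :=
  (v *m G *m w^T) 0 0.

(* A Riemannian metric, given by its coordinate matrices in the charts;
   [metric_change] says that they define one inner product on the tangent
   space at p. *)
Record riemannianMetric (R : realType) (n : nat) (M : topologicalType)
    (A : smoothAtlas R n M) := RiemannianMetric {
  metric_mx : chart_index A -> 'rV[R]_n -> 'M[R]_n ;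
  metric_smooth : forall i, smooth_on (chart i @` chart_dom i) (metric_mx i) ;
  metric_symmetric : forall i p, chart_dom i p ->
    (metric_mx i (chart i p))^T = metric_mx i (chart i p) ;
  metric_posdef : forall i p, chart_dom i p ->
    forall v, v != 0 -> 0 < bilin (metric_mx i (chart i p)) v v ;
  metric_change : forall i j p, chart_dom i p -> chart_dom j p ->
    forall v w,
      bilin (metric_mx i (chart i p)) v w =
      bilin (metric_mx j (chart j p))
        ('D_v (chart j \o chart_inv i) (chart i p))
        ('D_w (chart j \o chart_inv i) (chart i p))
}.

Section riemannian_distance.
Context {R : realType} {n : nat} {M : topologicalType} {A : smoothAtlas R n M}.
Variable g : riemannianMetric A.
Implicit Types (c : R -> M) (x y : M).

(* c is C^1 in a neighbourhood of each point of [0, 1], so that its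
   restriction to [0, 1] is C^1 up to the endpoints. *)
Definition C1_curve c : Prop := forall t, t \in `[0, 1] ->
  {for t, continuous c} /\
  forall i : chart_index A, chart_dom i (c t) ->
    (\forall s \near t, derivable (chart i \o c) s 1) /\
    {for t, continuous (derive1 (chart i \o c))}.

Definition speed c (t : R) : R :=
  let i := chart_at A (c t) in
  let v := derive1 (chart i \o c) t in
  Num.sqrt (bilin (metric_mx g i (chart i (c t))) v v).

Definition curve_length c : R :=
  (\int[@lebesgue_measure R]_(t in `[0, 1]) speed c t)%R.

(* x and y are the endpoints of a piecewise C^1 curve of length l, given as a
   concatenation of C^1 curves parametrized by [0, 1]. *)
Inductive joined x : M -> R -> Prop :=
| joined_refl : joined x x 0
| joined_cat y l c : joined x y l -> C1_curve c -> c 0 = y ->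
    joined x (c 1) (l + curve_length c).

Definition riemannian_distance x y : R := inf [set l | joined x y l].

End riemannian_distance.

Section bilipschitz.
Context {R : realType}.

(* A bi-Lipschitz homeomorphism together with its inverse; continuity of both
   follows from the Lipschitz conditions. *)
Record lipHomeo (M : pmetricType R) := LipHomeo {
  lip_fun :> M -> M ;
  lip_inv : M -> M ;
  lip_funK : cancel lip_fun lip_inv ;
  lip_invK : cancel lip_inv lip_fun ;
  lip_fun_lipschitz : exists K : R, forall x y,
    mdist (lip_fun x) (lip_fun y) <= K * mdist x y ;
  lip_inv_lipschitz : exists K : R, forall x y,
    mdist (lip_inv x) (lip_inv y) <= K * mdist x y
}.

Variable M : pmetricType R.

Lemma id_lipschitz : exists K : R, forall x y : M,
  mdist (id x) (id y) <= K * mdist x y.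
Proof. by exists 1 => x y; rewrite mul1r. Qed.

Definition lip_id : lipHomeo M :=
  LipHomeo (fun=> erefl) (fun=> erefl) id_lipschitz id_lipschitz.

HB.instance Definition _ := gen_eqMixin (lipHomeo M).
HB.instance Definition _ := gen_choiceMixin (lipHomeo M).
HB.instance Definition _ := isPointed.Build (lipHomeo M) lip_id.

(* the topology of uniform convergence *)
HB.instance Definition _ := Topological.copy (lipHomeo M)
  (initial_topology (fun f : lipHomeo M => (f : {uniform M -> M}))).

Definition lip_seminorm (f : M -> M) : R :=
  sup [set r | exists x y, x != y /\ r = mdist (f x) (f y) / mdist x y].

Definition lip_const (f : lipHomeo M) : R :=
  Num.max (lip_seminorm f) (lip_seminorm (lip_inv f)).

End bilipschitz.

Section stationary.
Context {R : realType} {M : pmetricType R}.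
Implicit Types (mu : probability (borelType (lipHomeo M)) R)
  (nu : probability (borelType M) R).

Definition convolution mu nu (B : set (borelType M)) : \bar R :=
  (\int[mu]_f pushforward nu (f : borelType M -> borelType M) B)%E.

Definition stationary mu nu : Prop :=
  forall B, measurable B -> convolution mu nu B = nu B.

Definition ae_invariant mu nu : Prop :=
  {ae mu, forall f : lipHomeo M, forall B, measurable B ->
    pushforward nu (f : borelType M -> borelType M) B = nu B}.

Definition log_holder (C alpha : R) nu : Prop :=
  forall (x : M) (r : R), 0 < r < 1 ->
    (nu (ball x r) <= (C * `|ln r| `^ (- alpha))%:E)%E.

End stationary.

(* Main.v *)
(* For a finite family of nonnegative continuous functions phi_a, put
   k(x, y) = sum_a phi_a(x) phi_a(y); the energy of nu, the double integral of k,
   is sum_a (int phi_a dnu)^2.  Square roots of softmax partitions of unity at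
   the scales e^-1, ..., e^-T give such kernels k_T with
   k_T(x, y) = min(T, |log d(x, y)|)^alpha (1 + o(1)) + O(1), uniformly in T.
   Only covering numbers polynomial in 1/r are needed, and straight segments in
   charts provide them.  A bound on the energies of stationary measures,
   uniform in T and nu, gives nu(B_r)^2 |log r|^alpha <= C.

   A bi-Lipschitz map changes |log d| by at most log L, so the energy of f_* nu
   is at most (1 + o(1)) times that of nu, up to O(1 + (log L(f))^alpha).  For a
   stationary nu the parallelogram identity then bounds the mean over f of
   ||f_* nu - nu||^2, in the norm given by k_T, by o(energy) + O(1).  If the
   energies of stationary nu_m were unbounded, then, almost surely in f, this
   discrepancy would be negligible with respect to the energy, for a suitable
   sequence; as the energy concentrates near the diagonal, its distribution
   psi |-> int psi(x) k(x, y) dnu dnu / energy would be asymptotically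
   f-invariant, and a limit along an ultrafilter would give a probability
   measure invariant under almost every f. *)

Require Import Defs.
From HB Require Import structures.
From mathcomp Require Import all_boot all_order all_algebra finmap.
From mathcomp Require Import all_classical all_reals all_analysis.
From mathcomp Require Import measurable_realfun ring lra.

Set Implicit Arguments.
Unset Strict Implicit.
Unset Printing Implicit Defensive.

Import Order.TTheory GRing.Theory Num.Theory.
Import numFieldNormedType.Exports.

Local Open Scope classical_set_scope.
Local Open Scope ring_scope.

(** * Covering numbers of a compact Riemannian manifold *)

Section geometry.
Context {R : realType}.

(** The obstacle is that the mean discrepancy is a difference of two energies which may both be
    huge: a kernel comparable to |log d|^alpha only up to a fixed factor would leave a multiple of
    the energy after subtraction. Hence every kernel estimate has the form (1 + eps) times the main
    term plus a constant, with eps arbitrary; the constant vanishes on division by an unbounded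
    energy. Such precision is available because a scale e^-j well above d(x, y) has a softmax kernel
    almost equal to 1, a scale well below d(x, y) has one almost equal to 0, and the scales in
    between carry a small fraction of the total weight.

    A truncated power of |log d| is not obviously positive definite, whereas a sum of products
    phi(x) phi(y) is so by construction. The energy is then a sum of squares, the discrepancy is a
    squared norm, and double integrals become finite sums of products of means, compared through
    pointwise inequalities between kernels. The price is that all constants have to be uniform in
    the truncation T. *)

Lemma derive_line (V W : normedModType R) (F : V -> W) (u w : V) (s : R) :
  'D_1 (fun t : R => F (u + t *: w)) s = 'D_w F (u + s *: w).
Proof.
rewrite /derive.
suff -> : (fun h : R => h^-1 *: (((fun t => F (u + t *: w)) \o shift s) (h *: 1) -
    F (u + s *: w))) = (fun h => h^-1 *: ((F \o shift (u + s *: w)) (h *: w) -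
    F (u + s *: w))) by [].
apply/funext => h /=; congr (_ *: (F _ - _)).
by rewrite scaler1 scalerDl addrCA.
Qed.

Lemma derivable_line (V W : normedModType R) (F : V -> W) (u w : V) (s : R) :
  derivable (fun t : R => F (u + t *: w)) s 1 <-> derivable F (u + s *: w) w.
Proof.
rewrite /derivable.
suff -> : (fun h : R => h^-1 *: (((fun t => F (u + t *: w)) \o shift s) (h *: 1) -
    F (u + s *: w))) = (fun h => h^-1 *: ((F \o shift (u + s *: w)) (h *: w) -
    F (u + s *: w))) by [].
apply/funext => h /=; congr (_ *: (F _ - _)).
by rewrite scaler1 scalerDl addrCA.
Qed.

Lemma ler_mx_entry_norm (m p : nat) (N : 'M[R]_(m, p)) i j : `|N i j| <= `|N|.
Proof.
rewrite [leRHS]mx_normrE.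
exact: (@le_bigmax _ _ _ 0 (fun ij : 'I_m * 'I_p => `|N ij.1 ij.2|) (i, j)).
Qed.

Lemma mx_norm_ler (m p : nat) (N : 'M[R]_(m, p)) (B : R) :
  0 <= B -> (forall i j, `|N i j| <= B) -> `|N| <= B.
Proof. by move=> B0 NB; rewrite [leLHS]mx_normrE bigmax_le. Qed.

(** The norm of a matrix is its largest entry in absolute value, hence n^2 for the n^2 terms of the
    double sum. *)
Lemma bilin_le (n : nat) (G : 'M[R]_n) (w : 'rV[R]_n) :
  bilin G w w <= n%:R ^+ 2 * `|G| * `|w| ^+ 2.
Proof.
rewrite /bilin mxE; apply: (@le_trans _ _
  (\sum_(j < n) n%:R * `|G| * `|w| ^+ 2)); last first.
  by rewrite sumr_const card_ord -[leLHS]mulr_natl expr2 !mulrA lexx.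
apply: ler_sum => j _; rewrite mxE mulr_suml.
apply: (@le_trans _ _ (\sum_(i < n) `|G| * `|w| ^+ 2)); last first.
  by rewrite sumr_const card_ord -[leLHS]mulr_natl !mulrA lexx.
apply: ler_sum => i _; rewrite mxE (le_trans (ler_norm _))// !normrM.
rewrite -mulrA mulrCA ler_pM// ?mulr_ge0// ?ler_mx_entry_norm//.
by rewrite expr2 ler_pM ?ler_mx_entry_norm.
Qed.

(* No measurability is needed, as the integral of a nonnegative function is a
   supremum over the simple functions below it. *)
Lemma le_integral_nonneg d (T : measurableType d)
    (mu : {measure set T -> \bar R}) (D : set T) (f1 f2 : T -> \bar R) :
  (forall x, D x -> 0 <= f1 x)%E -> (forall x, D x -> f1 x <= f2 x)%E ->
  (\int[mu]_(x in D) f1 x <= \int[mu]_(x in D) f2 x)%E.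
Proof.
move=> f10 f12; rewrite !ge0_integralE//; last first.
  by move=> x Dx; rewrite (le_trans (f10 _ Dx))// f12.
apply: ge_ereal_sup => _ [h/= hf <-]; apply: ereal_sup_ubound => /=.
exists h => // x; rewrite (le_trans (hf x))//.
by rewrite /patch; case: ifPn => // /set_mem; exact: f12.
Qed.

Lemma Rintegral01_le (f : R -> R) (B : R) :
  (forall t, t \in `[0, 1] -> 0 <= f t <= B) ->
  (\int[@lebesgue_measure R]_(t in `[0, 1]) f t)%R <= B.
Proof.
move=> fB.
have B0 : 0 <= B.
  by by have /fB/andP[+ +] : 0 \in `[0, 1 : R]; rewrite ?bound_itvE//; exact: le_trans.
have le : (\int[@lebesgue_measure R]_(t in `[0%R, 1%R]) (f t)%:E <= B%:E)%E.
  apply: (@le_trans _ _ (\int[@lebesgue_measure R]_(t in `[0%R, 1%R]) (cst B%:E t))%E).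
    by apply: le_integral_nonneg => t /= /fB /andP[]; rewrite !lee_fin.
  by rewrite integral_cst//= lebesgue_measure_itv/= lte01 sube0 mule1.
rewrite /Rintegral -[leRHS]/(fine B%:E) fine_le// ge0_fin_numE//.
  by rewrite (le_lt_trans le)// ltry.
by apply: integral_ge0 => t /= /fB /andP[]; rewrite lee_fin.
Qed.

(** * Straight segments in a chart *)

Section segments.
Variables (n : nat) (M : topologicalType) (A : smoothAtlas R n M).
Variables (i : chart_index A) (u w : 'rV[R]_n).
Hypothesis segment_in : forall t : R, t \in `[0, 1] ->
  (chart i @` chart_dom i) (u + t *: w).

Let segment (t : R) : M := chart_inv i (u + t *: w).

Lemma chart_segment t : t \in `[0, 1] ->
  chart_dom i (segment t) /\ chart i (segment t) = u + t *: w.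
Proof.
move=> /segment_in[p ip pE]; rewrite /segment -pE.
by rewrite chartK.
Qed.

Lemma line_continuous (t : R) : {for t, continuous (fun s : R => u + s *: w)}.
Proof. by apply: cvgD; [exact: cvg_cst|apply: cvgZr_tmp; exact: cvg_id]. Qed.

Lemma segment_continuous t : t \in `[0, 1] -> {for t, continuous segment}.
Proof.
move=> t01; have [ip pE] := chart_segment t01.
apply: (@continuous_comp _ _ _ (fun s : R => u + s *: w) (chart_inv i)).
  exact: line_continuous.
by rewrite -pE; exact: chart_inv_continuous.
Qed.

Lemma segment_transition (j : chart_index A) t : t \in `[0, 1] -> chart_dom j (segment t) ->
  (chart i @` (chart_dom i `&` chart_dom j)) (u + t *: w).
Proof.
move=> t01 jp; have [ip pE] := chart_segment t01.
by exists (segment t).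
Qed.

Lemma segment_near (j : chart_index A) t : t \in `[0, 1] -> chart_dom j (segment t) ->
  \forall s \near t,
    (chart i @` (chart_dom i `&` chart_dom j)) (u + s *: w).
Proof.
move=> t01 jp; have [ip pE] := chart_segment t01.
have im : \forall s \near t, (chart i @` chart_dom i) (u + s *: w).
  apply: (@line_continuous t); apply: open_nbhs_nbhs; split.
    exact: chart_image_open.
  exact: segment_in.
have jn : \forall s \near t, chart_dom j (segment s).
  apply: (segment_continuous t01); apply: open_nbhs_nbhs; split => //.
  exact: chart_dom_open.
apply: filterS2 im jn => s [q iq qE] jq; exists q => //; split => //.
by move: jq; rewrite /segment -qE chartK.
Qed.

Lemma derive1_chart_segment (j : chart_index A) t :
  derive1 (chart j \o segment) t = 'D_w (chart j \o chart_inv i) (u + t *: w).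
Proof. by rewrite derive1E -(derive_line (chart j \o chart_inv i)). Qed.

(** Read in a chart j, the segment is a transition map along a line. [Ck_on] of order 1 makes it
    derivable near t; order 2 makes its derivative, a directional derivative of the transition map,
    differentiable and hence continuous. *)
Lemma segment_C1 : @C1_curve R n M A segment.
Proof.
move=> t t01; split; first exact: segment_continuous.
move=> j jp; have near_j := segment_near t01 jp.
have [F1 _] := transition_smooth i j 1.
have [_ F2] := transition_smooth i j 2.
split.
  apply: filterS near_j => s /F1 Fs.
  apply/(derivable_line (chart j \o chart_inv i)); exact: diff_derivable.
have -> : derive1 (chart j \o segment) =
    'D_w (chart j \o chart_inv i) \o (fun s : R => u + s *: w).
  by apply/funext => s; exact: derive1_chart_segment.
apply: continuous_comp; first exact: line_continuous.
apply: differentiable_continuous.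
have [+ _] := F2 w; apply; exact: segment_transition.
Qed.

(** [speed] is computed in the chart selected at each point, which may change along the segment;
    [metric_change] brings it back to the single chart i. *)
Lemma segment_speed (g : riemannianMetric A) t : t \in `[0, 1] ->
  speed g segment t = Num.sqrt (bilin (metric_mx g i (u + t *: w)) w w).
Proof.
move=> t01; have [ip pE] := chart_segment t01.
rewrite /speed derive1_chart_segment; congr Num.sqrt.
rewrite -pE; apply/esym; apply: metric_change => //; exact: chart_at_dom.
Qed.

End segments.

Lemma curve_length_ge0 (n : nat) (M : topologicalType) (A : smoothAtlas R n M)
  (g : riemannianMetric A) (c : R -> M) : 0 <= curve_length g c.
Proof. by apply: Rintegral_ge0 => t _; exact: sqrtr_ge0. Qed.

Lemma riemannian_distance_le (n : nat) (M : topologicalType)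
    (A : smoothAtlas R n M) (g : riemannianMetric A) (c : R -> M) :
  @C1_curve R n M A c -> riemannian_distance g (c 0) (c 1) <= curve_length g c.
Proof.
move=> C1c; apply: ge_inf.
  exists 0 => l /= j; elim: j => // y l' c' _ l0 _ _.
  by rewrite addr_ge0// curve_length_ge0.
by rewrite /= -[curve_length g c]add0r; apply: joined_cat => //; exact: joined_refl.
Qed.

Lemma ball_rV (n : nat) (x y : 'rV[R]_n) (e : R) : ball x e y = (`|x - y| < e).
Proof. by rewrite mx_norm_ball. Qed.

Lemma segment_in_ball (n : nat) (x u v : 'rV[R]_n) (e t : R) :
  ball x e u -> ball x e v -> t \in `[0, 1] -> ball x e (u + t *: (v - u)).
Proof.
rewrite !ball_rV in_itv/= => xu xv /andP[t0 t1].
have -> : x - (u + t *: (v - u)) = (1 - t) *: (x - u) + t *: (x - v).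
  rewrite !scalerBr !scalerBl !scale1r.
  apply/matrixP => i j; rewrite !mxE; ring.
rewrite (le_lt_trans (ler_normD _ _))// !normrZ (ger0_norm t0).
rewrite ger0_norm ?subr_ge0//.
have [->|t_neq0] := eqVneq t 0; first by rewrite subr0 mul1r mul0r addr0.
have tgt0 : 0 < t by rewrite lt_neqAle eq_sym t_neq0.
rewrite [ltRHS](_ : e = (1 - t) * e + t * e); last by ring.
by rewrite ler_ltD ?ltr_pM2l// ler_wpM2l ?subr_ge0// ltW.
Qed.

(** On a small coordinate ball the metric matrix is bounded, by continuity. Balls being convex, the
    segment from x to y stays there, and its length is at most a constant times the coordinate
    distance. *)
Lemma chart_locally_lipschitz (n : nat) (M : topologicalType)
    (A : smoothAtlas R n M) (g : riemannianMetric A) (i : chart_index A) (p : M) :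
  chart_dom i p -> exists rho K : R, [/\ 0 < rho, 0 <= K &
    forall x y, chart_dom i x -> chart_dom i y ->
      ball (chart i p) rho (chart i x) -> ball (chart i p) rho (chart i y) ->
      riemannian_distance g x y <= K * `|chart i y - chart i x|].
Proof.
move=> ip; set u0 := chart i p.
have im_u0 : (chart i @` chart_dom i) u0 by exists p.
have G_cont : {for u0, continuous (metric_mx g i)} := metric_smooth g i 0 u0 im_u0.
have near_im : nbhs u0 (chart i @` chart_dom i).
  by apply: open_nbhs_nbhs; split => //; exact: chart_image_open.
have near_G : nbhs u0 [set u | `|metric_mx g i u| < `|metric_mx g i u0| + 1].
  move/cvgrPdist_lt: G_cont => /(_ 1 ltr01); apply: filterS => u /= Gu.
  have -> : metric_mx g i u = metric_mx g i u0 - (metric_mx g i u0 - metric_mx g i u).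
    by rewrite subKr.
  by rewrite (le_lt_trans (ler_normB _ _))// ltrD2l.
have /nbhs_ballP[rho/= rho0 sub] : nbhs u0 ((chart i @` chart_dom i) `&`
    [set u | `|metric_mx g i u| < `|metric_mx g i u0| + 1]) by exact: filterI.
set B := `|metric_mx g i u0| + 1.
have B0 : 0 <= B by rewrite addr_ge0.
exists rho, (Num.sqrt (n%:R ^+ 2 * B)); split => // x y ix iy xb yb.
pose u := chart i x; pose w := chart i y - u.
have seg_in t : t \in `[0, 1] -> ball u0 rho (u + t *: w).
  exact: segment_in_ball.
have seg_im t : t \in `[0, 1] -> (chart i @` chart_dom i) (u + t *: w).
  by move=> /seg_in/sub[].
pose c t := chart_inv i (u + t *: w).
have c0 : c 0 = x by rewrite /c scale0r addr0 chartK.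
have c1 : c 1 = y by rewrite /c scale1r addrC subrK chartK.
have : riemannian_distance g (c 0) (c 1) <= curve_length g c.
  by apply: riemannian_distance_le; exact: segment_C1.
rewrite c0 c1 => /le_trans; apply.
apply: Rintegral01_le => t t01; rewrite sqrtr_ge0/= segment_speed//.
have -> : `|chart i y - chart i x| = Num.sqrt (`|w| ^+ 2) by rewrite sqrtr_sqr normr_id.
rewrite -sqrtrM ?mulr_ge0 ?sqr_ge0//.
apply: ler_wsqrtr; apply: (le_trans (bilin_le _ _)).
rewrite ler_wpM2r ?sqr_ge0// ler_wpM2l ?sqr_ge0//.
by have [_ /ltW] := sub _ (seg_in _ t01).
Qed.

(** * Grids and covering numbers *)

Lemma grid_cell (a b c : R) (k : nat) : 0 <= a < c -> 0 <= b < c ->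
  Num.truncn (a * k.+1%:R / c) = Num.truncn (b * k.+1%:R / c) ->
  `|a - b| <= c / k.+1%:R.
Proof.
move=> /andP[a0 ac] /andP[b0 bc]; have c0 : 0 < c by exact: le_lt_trans ac.
have k0 : 0 < k.+1%:R :> R by [].
set x := a * _ / _; set y := b * _ / _ => xy.
have x0 : 0 <= x by rewrite divr_ge0 ?mulr_ge0// ltW.
have y0 : 0 <= y by rewrite divr_ge0 ?mulr_ge0// ltW.
have := truncn_itv x0; have := truncn_itv y0; rewrite xy -natr1.
move=> /andP[y1 y2] /andP[x1 x2].
have -> : a - b = (x - y) * (c / k.+1%:R) by rewrite /x /y; field; rewrite !gt_eqF.
have ck0 : 0 <= c / k.+1%:R by rewrite divr_ge0// ltW.
rewrite normrM (ger0_norm ck0) -[leRHS]mul1r ler_wpM2r// ler_norml.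
by apply/andP; split; lra.
Qed.

Lemma grid_truncn_lt (a c : R) (k : nat) : 0 <= a < c ->
  (Num.truncn (a * k.+1%:R / c) < k.+1)%N.
Proof.
move=> /andP[a0 ac]; have c0 : 0 < c by exact: le_lt_trans ac.
have x0 : 0 <= a * k.+1%:R / c by rewrite divr_ge0 ?mulr_ge0// ltW.
rewrite -(ltr_nat R) (@le_lt_trans _ _ (a * k.+1%:R / c)) ?truncn_le//.
rewrite ltr_pdivrMr// mulrC.
by rewrite ltr_pM2l.
Qed.

Lemma ball_grid (n k : nat) (u0 : 'rV[R]_n) (rho : R) :
  exists cell : 'rV[R]_n -> {ffun 'I_n -> 'I_k.+1},
    forall u v, ball u0 rho u -> ball u0 rho v -> cell u = cell v ->
    `|u - v| <= 2 * rho / k.+1%:R.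
Proof.
pose shifted (u : 'rV[R]_n) j := u ord0 j - u0 ord0 j + rho.
(* Each coordinate is shifted into [0, 2 rho) and cut into k + 1 equal intervals. On the ball the
   index is below k + 1, so [inord] does not fall back on its default value. *)
exists (fun u => [ffun j => inord (Num.truncn (shifted u j * k.+1%:R / (2 * rho)))]).
move=> u v; rewrite !ball_rV => u0u u0v.
have rho0 : 0 < rho by exact: le_lt_trans u0u.
have shiftedP (w : 'rV[R]_n) j : `|u0 - w| < rho -> 0 <= shifted w j < 2 * rho.
  move=> u0w; have := ler_mx_entry_norm (u0 - w) ord0 j; rewrite !mxE.
  move=> /le_lt_trans/(_ u0w); rewrite ltr_norml /shifted => /andP[h1 h2].
  by apply/andP; split; lra.
move=> /ffunP cells; apply: mx_norm_ler.
  by rewrite divr_ge0// mulr_ge0 ?ltW.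
move=> i j; rewrite (ord1 i) !mxE.
have := cells j; rewrite !ffunE => /(congr1 (@nat_of_ord _)).
rewrite !inordK ?grid_truncn_lt ?shiftedP// => cj.
have -> : u ord0 j - v ord0 j = shifted u j - shifted v j by rewrite /shifted; ring.
by apply: grid_cell => //; exact: shiftedP.
Qed.

Section covering.
Variables (n : nat) (M : pmetricType R) (A : smoothAtlas R n M).
Variable g : riemannianMetric A.
Hypothesis M_compact : compact [set: M].
Hypothesis M_dist : forall x y : M, mdist x y = riemannian_distance g x y.

Lemma local_covering (p : M) : exists (U : set M) (K : R),
  [/\ nbhs p U, 0 <= K & forall k : nat, exists s : seq M,
    size s = (k.+1 ^ n)%N /\
    forall x, U x -> exists2 y, y \in s & mdist x y <= K / k.+1%:R].
Proof.
pose i := chart_at A p; have ip : chart_dom i p := chart_at_dom A p.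
have [rho [K [rho0 K0 lip]]] := chart_locally_lipschitz g ip.
pose U := chart_dom i `&` [set x | ball (chart i p) rho (chart i x)].
exists U, (K * (2 * rho)); split.
- apply: filterI; first by apply: open_nbhs_nbhs; split=> //; exact: chart_dom_open.
  by apply: (chart_continuous ip); exact: nbhsx_ballx.
- by rewrite mulr_ge0// mulr_ge0 ?ltW.
- move=> k; have [cell cellP] := ball_grid k (chart i p) rho.
  (* One representative per occupied cell; p is only the default for empty cells. *)
  pose rep c := xget p [set x | U x /\ cell (chart i x) = c].
  exists [seq rep c | c <- enum {ffun 'I_n -> 'I_k.+1}]; split.
    by rewrite size_map -cardE card_ffun !card_ord.
  move=> x Ux; exists (rep (cell (chart i x))).
    by apply/map_f; rewrite mem_enum.
  have : [set y | U y /\ cell (chart i y) = cell (chart i x)]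
      (rep (cell (chart i x))) by rewrite /rep; case: xgetP => [y -> //|/(_ x)[]].
  move: (rep _) => y [Uy yx]; have [ix bx] := Ux; have [iy by'] := Uy.
  rewrite M_dist -mulrA (le_trans (lip _ _ _ _ _ _))// ler_wpM2l//.
  exact: cellP.
Qed.

Lemma polynomial_covering : exists (P : nat) (K : R), 0 <= K /\
  forall k : nat, exists s : seq M, (size s <= P * k.+1 ^ n)%N /\
    forall x, exists2 y, y \in s & mdist x y <= K / k.+1%:R.
Proof.
have /choice[U /choice[K UK]] := local_covering.
have := M_compact; rewrite compact_cover => /(_ M setT (fun p => (U p)^°)) [].
- by move=> p _; exact: open_interior.
- move=> p _; exists p => //; by have [] := UK p.
move=> D _ D_cover.
exists (size (enum_fset D)), (\big[Num.max/0]_(p <- enum_fset D) K p).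
split; first exact: bigmax_ge_id.
move=> k; have /choice[s sP] : forall p, exists s : seq M, size s = (k.+1 ^ n)%N /\
    forall x, U p x -> exists2 y, y \in s & mdist x y <= K p / k.+1%:R.
  by move=> p; have [_ _] := UK p.
exists (flatten [seq s p | p <- enum_fset D]); split.
  rewrite size_flatten /shape -map_comp sumnE big_map.
  rewrite (eq_bigr (fun=> k.+1 ^ n)%N) => [|p _]; last by have [] := sP p.
  by rewrite big_const_seq count_predT iter_addn_0 mulnC.
move=> x; have [p pD Upx] := D_cover x Logic.I.
have [_ /(_ x (interior_subset Upx))[y ys xy]] := sP p.
exists y; first by apply/flattenP; exists (s p) => //; exact: map_f.
apply: (le_trans xy); rewrite ler_wpM2r ?invr_ge0//.
exact: le_bigmax_seq.
Qed.

Lemma exponential_covering : exists D : R, 0 <= D /\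
  forall j : nat, exists s : seq M, (size s)%:R <= expR (D * j.+1%:R) /\
    forall x, exists2 y, y \in s & mdist x y <= expR (- j%:R).
Proof.
have [P [K [K0 cover]]] := polynomial_covering.
(* With k the integer part of K e^j, the net has at most P ((K + 1) e^j)^n points. The constant
   comes from P <= e^P and (K + 1) e^j <= e^(K + j) <= e^((K + 2)(j + 1)). *)
exists (P%:R + n%:R * (K + 2)); split.
  by rewrite addr_ge0 ?mulr_ge0// addr_ge0.
move=> j; pose e := expR (j%:R : R); have e0 : 0 < e by exact: expR_gt0.
have e1 : 1 <= e by rewrite -expR0 ler_expR.
have Ke0 : 0 <= K * e by rewrite mulr_ge0// ltW.
have [s [sz sP]] := cover (Num.truncn (K * e)).
have /andP[k1 k2] := truncn_itv Ke0.
exists s; split.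
  rewrite (@le_trans _ _ (P%:R * ((K + 1) * e) ^+ n))//.
    rewrite (le_trans (_ : _ <= (P * (Num.truncn (K * e)).+1 ^ n)%:R)) ?ler_nat//.
    rewrite natrM natrX ler_wpM2l// lerXn2r ?nnegrE ?mulr_ge0 ?addr_ge0//; first exact: ltW.
    rewrite -natr1 mulrDl mul1r lerD//.
  have -> : (P%:R + n%:R * (K + 2)) * j.+1%:R = P%:R * j.+1%:R +
      n%:R * ((K + 2) * j.+1%:R) by ring.
  rewrite expRD [expR (n%:R * _)]expRM_natl ler_pM ?exprn_ge0 ?mulr_ge0 ?addr_ge0//;
    first exact: ltW.
    rewrite ltW// (lt_le_trans (_ : _ < P%:R + 1))//; first by rewrite ltrDl.
    rewrite addrC (le_trans (expR_ge1Dx _))// ler_expR ler_peMr// -natr1 lerDr//.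
  rewrite lerXn2r ?nnegrE ?expR_ge0 ?mulr_ge0 ?addr_ge0//; first exact: ltW.
  apply: (@le_trans _ _ (expR K * e)).
    by rewrite ler_wpM2r ?(ltW e0)// addrC expR_ge1Dx.
  rewrite -expRD ler_expR -natr1.
  have : 0 <= K * j%:R by rewrite mulr_ge0.
  have : (0 : R) <= j%:R by []. lra.
move=> x; have [y ys xy] := sP x; exists y => //; rewrite (le_trans xy)//.
by rewrite expRN ler_pdivrMr// mulrC ler_pdivlMr// ltW.
Qed.

End covering.
End geometry.

(** * Kernels comparable to a power of the logarithm of the distance *)

Section softmax.
Context {R : realType} {M : pmetricType R}.
Implicit Types (s : seq M) (c : R).

Lemma mdist_continuous (p : M) : continuous (fun x : M => mdist x p).
Proof.
move=> x; apply/cvgrPdist_lt => e e0.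
near=> y; have : ball x e y by near: y; exact: nbhsx_ballx.
rewrite ballEmdist/= => xy; rewrite (le_lt_trans _ xy)// ler_norml.
have := metric_triangle x y p; have := metric_triangle y x p.
by rewrite (metric_sym y x) => h1 h2; apply/andP; split; lra.
Unshelve. all: by end_near. Qed.

Definition bump c (p x : M) : R := expR (- c * mdist x p).

Definition bump_norm s c x : R := Num.sqrt (\sum_(q <- s) bump c q x ^+ 2).

(* Square roots of the softmax weights of the points of s. *)
Definition softmax s c (p x : M) : R := bump c p x / bump_norm s c x.

(** An inner product of two unit vectors, since the squares of the weights sum to 1; it is therefore
    1 on the diagonal and at most 1 elsewhere. *)
Definition softmax_kernel s c x y : R :=
  \sum_(p <- s) softmax s c p x * softmax s c p y.

Lemma bump_gt0 c p x : 0 < bump c p x.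
Proof. exact: expR_gt0. Qed.

Lemma bump_ge0 c p x : 0 <= bump c p x.
Proof. exact: expR_ge0. Qed.

Lemma bump_sum_gt0 s c x : s != [::] -> 0 < \sum_(q <- s) bump c q x ^+ 2.
Proof.
case: s => // q s _; rewrite big_cons ltr_pwDl ?exprn_gt0 ?bump_gt0//.
by apply: sumr_ge0 => p _; exact: sqr_ge0.
Qed.

Lemma bump_norm_gt0 s c x : s != [::] -> 0 < bump_norm s c x.
Proof. by move=> s0; rewrite sqrtr_gt0 bump_sum_gt0. Qed.

Lemma softmax_ge0 s c p x : 0 <= softmax s c p x.
Proof. by rewrite divr_ge0 ?sqrtr_ge0 ?bump_ge0. Qed.

Lemma bump_continuous c p : continuous (bump c p).
Proof.
move=> x; apply: (@continuous_comp _ _ _ (fun x => - c * mdist x p) expR); last first.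
  exact: continuous_expR.
by apply: cvgM; [exact: cvg_cst|exact: mdist_continuous].
Qed.

Lemma continuous_big_sum (I : Type) (s : seq I) (F : I -> M -> R) :
  (forall i, continuous (F i)) -> continuous (fun x => \sum_(i <- s) F i x).
Proof.
move=> F_cont; elim: s => [|i s IH].
  rewrite (_ : (fun x => _) = cst 0); first exact: cst_continuous.
  by apply/funext => x; rewrite big_nil.
rewrite (_ : (fun x => _) = (fun x => F i x + \sum_(j <- s) F j x)).
  by move=> x; apply: cvgD; [exact: F_cont|exact: IH].
by apply/funext => x; rewrite big_cons.
Qed.

Lemma softmax_continuous s c p : s != [::] -> continuous (softmax s c p).
Proof.
move=> s0 x; apply: cvgM; first exact: bump_continuous.
apply: cvgV; first by rewrite gt_eqF// bump_norm_gt0.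
apply: (@continuous_comp _ _ _ (fun x => \sum_(q <- s) bump c q x ^+ 2) Num.sqrt).
  apply: continuous_big_sum => q.
  rewrite (_ : (fun x => _) = (fun x => bump c q x * bump c q x)) => [y|].
    by apply: cvgM; exact: bump_continuous.
  by apply/funext => y; rewrite expr2.
exact: sqrt_continuous.
Qed.

Lemma softmax_kernelxx s c x : s != [::] -> softmax_kernel s c x x = 1.
Proof.
move=> s0; rewrite /softmax_kernel.
under eq_bigr do rewrite -expr2 expr_div_n.
rewrite -mulr_suml sqr_sqrtr ?divff ?gt_eqF ?bump_sum_gt0//.
by rewrite ltW ?bump_sum_gt0.
Qed.

Lemma softmax_kernel_ge0 s c x y : 0 <= softmax_kernel s c x y.
Proof. by apply: sumr_ge0 => p _; rewrite mulr_ge0 ?softmax_ge0. Qed.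

Lemma softmax_kernel_le1 s c x y : s != [::] -> softmax_kernel s c x y <= 1.
Proof.
move=> s0; have -> : 1 = (softmax_kernel s c x x + softmax_kernel s c y y) / 2.
  by rewrite !softmax_kernelxx//; field.
rewrite -big_split/= mulr_suml; apply: ler_sum => p _.
move: (softmax s c p x) (softmax s c p y) => a b.
by have := sqr_ge0 (a - b); nra.
Qed.

Lemma bump_lipschitz c p x y : 0 <= c ->
  bump c p x * expR (- c * mdist x y) <= bump c p y.
Proof.
move=> c0; rewrite -expRD ler_expR -mulrDr !mulNr lerN2 ler_wpM2l//.
by rewrite addrC (metric_sym x y) metric_triangle.
Qed.

(** The logarithms of the bumps and of their norm are c-Lipschitz, so each weight changes by a
    factor at least e^(-2 c d(x, y)) from x to y. The kernel is then compared with its value 1 at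
    (x, x). *)
Lemma softmax_kernel_near s c x y : s != [::] -> 0 <= c ->
  expR (- (2 * c * mdist x y)) <= softmax_kernel s c x y.
Proof.
move=> s0 c0; set e := expR (- c * mdist x y).
have e0 : 0 < e by exact: expR_gt0.
have -> : expR (- (2 * c * mdist x y)) = e * e by rewrite -expRD; congr expR; ring.
have norm_le : bump_norm s c y <= bump_norm s c x / e.
  rewrite ler_pdivlMr//.
  have -> : bump_norm s c y * e = Num.sqrt (\sum_(q <- s) (bump c q y * e) ^+ 2).
    under eq_bigr do rewrite exprMn.
    rewrite -mulr_suml sqrtrM ?ltW ?bump_sum_gt0//.
    by rewrite sqrtr_sqr gtr0_norm.
  apply: ler_wsqrtr; apply: ler_sum => q _.
  rewrite lerXn2r ?nnegrE ?mulr_ge0 ?bump_ge0 ?(ltW e0)//.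
  by rewrite /e metric_sym bump_lipschitz.
have soft_le p : softmax s c p x * (e * e) <= softmax s c p y.
  rewrite /softmax ler_pdivlMr ?bump_norm_gt0//.
  apply: le_trans (bump_lipschitz p x y c0); rewrite -/e.
  have -> : bump c p x * e = bump c p x / bump_norm s c x * (e * e) *
      (bump_norm s c x / e).
    by field; rewrite !gt_eqF ?bump_norm_gt0.
  rewrite ler_wpM2l// !mulr_ge0 ?bump_ge0 ?(ltW e0)// invr_ge0 sqrtr_ge0//.
rewrite -[leLHS]mul1r -(softmax_kernelxx c x s0) mulr_suml.
by apply: ler_sum => p _; rewrite -mulrA ler_wpM2l ?softmax_ge0.
Qed.

Lemma softmax_le1 s c p x : p \in s -> softmax s c p x <= 1.
Proof.
move=> ps; have s0 : s != [::] by case: s ps.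
rewrite ler_pdivrMr ?bump_norm_gt0// mul1r.
rewrite -[leLHS](@gtr0_norm _) ?bump_gt0// -sqrtr_sqr; apply: ler_wsqrtr.
rewrite (big_rem p ps)/= lerDl sumr_ge0// => q _; exact: sqr_ge0.
Qed.

(** The net point q makes the normalization at least e^(-c r), while the bump of p is at most e^(-3
    c r). *)
Lemma softmax_far s c p x r : 0 <= c ->
  (exists2 q, q \in s & mdist x q <= r) -> 3 * r <= mdist x p ->
  softmax s c p x <= expR (- (2 * c * r)).
Proof.
move=> c0 [q qs xq] xp; have s0 : s != [::] by case: s qs.
rewrite ler_pdivrMr ?bump_norm_gt0//.
apply: (@le_trans _ _ (expR (- (2 * c * r)) * bump c q x)).
  rewrite -expRD ler_expR.
  have := ler_wpM2l c0 xq; have := ler_wpM2l c0 xp; lra.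
rewrite ler_wpM2l ?expR_ge0//.
rewrite -[leLHS](@gtr0_norm _) ?bump_gt0// -sqrtr_sqr; apply: ler_wsqrtr.
rewrite (big_rem q qs)/= lerDl sumr_ge0// => ? _; exact: sqr_ge0.
Qed.

(** Every p is at distance at least 3 r from x or from y, so in each term one factor is at most
    e^(-2 c r) and the other at most 1. *)
Lemma softmax_kernel_far s c x y r : 0 <= c ->
  (forall z, exists2 q, q \in s & mdist z q <= r) -> 6 * r < mdist x y ->
  softmax_kernel s c x y <= (size s)%:R * expR (- (2 * c * r)).
Proof.
move=> c0 net xy; set e := expR _.
have -> : (size s)%:R * e = \sum_(p <- s) e.
  by rewrite big_const_seq count_predT iter_addr addr0 mulr_natl.
rewrite /softmax_kernel big_seq [leRHS]big_seq; apply: ler_sum => p ps.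
have [xp|px] := leP (3 * r) (mdist x p).
  rewrite -[leRHS]mulr1 ler_pM ?softmax_ge0 ?softmax_le1//.
  exact: softmax_far.
rewrite -[leRHS]mul1r ler_pM ?softmax_ge0 ?softmax_le1//.
apply: softmax_far => //; have := metric_triangle x p y.
rewrite (metric_sym p y); lra.
Qed.

End softmax.

(** * Elementary estimates *)

Section powR_estimates.
Context {R : realType}.
Implicit Types a b d : R.

(** Either b <= e a with (1 + e)^alpha = 1 + d, or a < b / e and the sum is at most (1/e + 1) b.
    Thanks to this, a shift of the logarithm costs a factor 1 + d and an additive term. *)
Lemma powR_add_le (alpha d : R) : 0 < alpha -> 0 < d ->
  exists C : R, 0 <= C /\ forall a b, 0 <= a -> 0 <= b ->
    (a + b) `^ alpha <= (1 + d) * a `^ alpha + C * b `^ alpha.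
Proof.
move=> alpha0 d0.
have d1 : 0 < 1 + d by rewrite addr_gt0.
pose k := (1 + d) `^ alpha^-1.
have k1 : 1 < k.
  by rewrite /k /powR gt_eqF// -[ltLHS]expR0 ltr_expR mulr_gt0 ?invr_gt0// ln_gt0// ltrDl.
have kE : k `^ alpha = 1 + d by rewrite /k -powRrM mulVf ?gt_eqF// powRr1// ltW.
pose e := k - 1; have e0 : 0 < e by rewrite subr_gt0.
exists ((e^-1 + 1) `^ alpha); split=> [|a b a0 b0]; first exact: powR_ge0.
have [bea|eab] := leP b (e * a).
  apply: (@le_trans _ _ ((1 + d) * a `^ alpha)); last first.
    by rewrite lerDl mulr_ge0 ?powR_ge0.
  have ka : a + b <= k * a by rewrite -[k](subrK 1) -/e; lra.
  rewrite -kE -powRM ?(ltW (lt_trans _ k1))//.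
  by apply: ge0_ler_powR; rewrite ?nnegrE ?addr_ge0 ?mulr_ge0 ?(ltW alpha0)// ltW// (lt_trans _ k1).
apply: (@le_trans _ _ ((e^-1 + 1) `^ alpha * b `^ alpha)); last first.
  by rewrite lerDr mulr_ge0 ?powR_ge0// ltW.
have e'0 : 0 < e^-1 by rewrite invr_gt0.
rewrite -powRM ?addr_ge0 ?(ltW e'0)//.
apply: ge0_ler_powR; rewrite ?nnegrE ?addr_ge0 ?mulr_ge0 ?addr_ge0 ?(ltW alpha0) ?(ltW e'0)//.
by rewrite mulrDl mul1r lerD2r mulrC ler_pdivlMr// mulrC ltW.
Qed.

(** From e^u >= (u / 2)^2 with u = c x. *)
Lemma mul_expRN_le (c x : R) : 0 < c -> 0 < x ->
  x * expR (- (c * x)) <= 4 / (c ^+ 2 * x).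
Proof.
move=> c0 x0; have cx0 : 0 < c * x by rewrite mulr_gt0.
rewrite expRN ler_pdivrMr ?expR_gt0// mulrAC ler_pdivlMr ?mulr_gt0 ?exprn_gt0//.
have -> : expR (c * x) = expR (c * x / 2) ^+ 2.
  by rewrite -expRM_natl; congr expR; field.
have h : (c * x / 2) <= expR (c * x / 2).
  by rewrite (le_trans _ (expR_ge1Dx _))// lerDr.
have : (c * x / 2) ^+ 2 <= expR (c * x / 2) ^+ 2.
  by rewrite lerXn2r ?nnegrE ?expR_ge0// divr_ge0// ltW.
nra.
Qed.

(** The partial sums are at most 1 - e^-T by induction, because e >= 2. *)
Lemma sum_expRN_le1 (T : nat) : \sum_(j < T) expR (- j.+1%:R : R) <= 1.
Proof.
suff : \sum_(j < T) expR (- j.+1%:R : R) <= 1 - expR (- T%:R).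
  by move/le_trans; apply; rewrite lerBlDr lerDl expR_ge0.
elim: T => [|T IH]; first by rewrite big_ord0 oppr0 expR0 subrr.
rewrite big_ord_recr/=.
suff : 2 * expR (- T.+1%:R : R) <= expR (- T%:R) by lra.
rewrite (_ : - T%:R = 1 + - T.+1%:R) ?expRD; last by rewrite -natr1; ring.
by rewrite ler_wpM2r ?expR_ge0// (le_trans _ (expR_ge1Dx _))//; lra.
Qed.

End powR_estimates.

(** * The truncated logarithm of the distance *)

Section multiscale.
Context {R : realType} {M : pmetricType R}.

Definition feature_kernel (fs : seq (M -> R)) (x y : M) : R :=
  \sum_(phi <- fs) phi x * phi y.

(* [max(0, min(T, - log d(x, y)))] *)
Definition log_cutoff (T : nat) (x y : M) : R :=
  Num.max 0 (- ln (Num.max (mdist x y) (expR (- T%:R)))).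

Lemma log_cutoff_ge0 T x y : 0 <= log_cutoff T x y.
Proof. by rewrite le_max lexx. Qed.

Let max_gt0 T (x y : M) : 0 < Num.max (mdist x y) (expR (- T%:R)).
Proof. by rewrite lt_max expR_gt0 orbT. Qed.

Lemma log_cutoff_le T x y : log_cutoff T x y <= T%:R.
Proof.
rewrite ge_max ler0n/= lerNl -[leLHS]expRK ler_ln ?posrE ?expR_gt0//.
by rewrite le_max lexx orbT.
Qed.

Lemma mdist_le_log_cutoff T x y : 0 < log_cutoff T x y ->
  mdist x y <= expR (- log_cutoff T x y).
Proof.
rewrite /log_cutoff lt_max ltxx/= => l0.
rewrite (max_r (ltW l0)) opprK lnK ?posrE// le_max lexx//.
Qed.

Lemma le_log_cutoff T x y (a : R) : mdist x y <= expR (- a) -> a <= T%:R ->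
  a <= log_cutoff T x y.
Proof.
move=> xy aT; rewrite le_max; apply/orP; right.
by rewrite lerNr -[leRHS]expRK ler_ln ?posrE ?expR_gt0// ge_max xy ler_expR lerN2.
Qed.

(** The shift of the logarithm survives both truncations because ln L >= 0. *)
Lemma log_cutoff_shift T x y x' y' (L : R) : 1 <= L ->
  mdist x y <= L * mdist x' y' -> log_cutoff T x' y' <= log_cutoff T x y + ln L.
Proof.
move=> L1 xy; have L0 : 0 < L by exact: lt_le_trans L1.
have lnL : 0 <= ln L by exact: ln_ge0.
rewrite ge_max addr_ge0 ?log_cutoff_ge0//=.
apply: (@le_trans _ _ (- ln (Num.max (mdist x y) (expR (- T%:R))) + ln L)); last first.
  by rewrite lerD2r le_max lexx orbT.
set m := Num.max _ _; set m' := Num.max _ _.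
suff : ln m' <= ln L + ln m by lra.
rewrite /m /m' -lnM ?posrE// ler_ln ?posrE ?mulr_gt0//.
rewrite ge_max; apply/andP; split.
  by rewrite (le_trans xy)// ler_wpM2l ?(ltW L0)// le_max lexx.
rewrite (@le_trans _ _ (L * expR (- T%:R)))//.
  by rewrite ler_peMl// expR_ge0.
by rewrite ler_wpM2l ?(ltW L0)// le_max lexx orbT.
Qed.

End multiscale.

(** * The multiscale kernel *)

Section log_kernel.
Context {R : realType} {M : pmetricType R}.
Variables (alpha D : R) (net : nat -> seq M).
Hypotheses (alpha_gt0 : 0 < alpha) (D_ge0 : 0 <= D).
Hypothesis net_size : forall j, (size (net j))%:R <= expR (D * j.+1%:R).
Hypothesis net_dense : forall j x,
  exists2 y, y \in net j & mdist x y <= expR (- j%:R).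

(** At scale j the softmax tail e^(-b (j + 1)) must absorb the net, of size at most e^(2 D (j + 1)),
    and the weight, at most e^(alpha (j + 1)), and leave the summable e^(-(j + 1)). *)
Let b : R := 2 * D + alpha + 1.

Let b_gt0 : 0 < b.
Proof. by rewrite /b ltr_pwDr// addr_ge0 ?mulr_ge0// ltW. Qed.

(** Increments of t^alpha: over j < t they telescope to t^alpha. *)
Definition scale_weight (j : nat) : R := j.+1%:R `^ alpha - j%:R `^ alpha.

(* Growing linearly in j, this makes the tails of the softmax beat the size of
   the net; a linear factor costs nothing on the logarithmic scale. *)
Definition scale_rate (j : nat) : R := b * j.+1%:R * expR j.+1%:R / 2.

Definition scale_kernel (j : nat) (x y : M) : R :=
  softmax_kernel (net j.+1) (scale_rate j) x y.

Definition log_family (T : nat) : seq (M -> R) :=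
  [seq (fun x => Num.sqrt (scale_weight j) * softmax (net j.+1) (scale_rate j) p x)
    | j <- iota 0 T, p <- net j.+1].

Let net_neq0 j : net j != [::].
Proof. by have [y + _] := net_dense j point; case: (net j). Qed.

Let scale_rate_ge0 j : 0 <= scale_rate j.
Proof. by rewrite /scale_rate divr_ge0 ?mulr_ge0 ?expR_ge0// ltW. Qed.

Lemma scale_weight_ge0 j : 0 <= scale_weight j.
Proof.
by rewrite subr_ge0 ge0_ler_powR ?(ltW alpha_gt0) ?nnegrE// ler_nat.
Qed.

Lemma sum_scale_weight (T t : nat) :
  \sum_(j < T | (j < t)%N) scale_weight j = (minn T t)%:R `^ alpha.
Proof.
elim: T => [|T IH]; first by rewrite big_ord0 min0n powR0 ?gt_eqF.
rewrite big_mkcond big_ord_recr/= -big_mkcond/= {}IH.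
have [Tt|tT] := ltnP T t.
  by rewrite (minn_idPl Tt) addrC subrK.
by rewrite (minn_idPr (leqW tT)) addr0.
Qed.

Lemma log_family_kernel T x y : feature_kernel (log_family T) x y =
  \sum_(j < T) scale_weight j * scale_kernel j x y.
Proof.
rewrite /feature_kernel /log_family big_allpairs_dep/= -val_enum_ord big_map big_enum.
apply: eq_bigr => j _; rewrite /scale_kernel mulr_sumr; apply: eq_bigr => p _.
by rewrite mulrACA -expr2 sqr_sqrtr ?scale_weight_ge0.
Qed.

Lemma log_family_continuous_ge0 T phi : phi \in log_family T ->
  continuous phi /\ forall x, 0 <= phi x.
Proof.
move=> /allpairsPdep[j [p [_ _ ->]]]; split => [x|x]; last first.
  by rewrite mulr_ge0 ?sqrtr_ge0 ?softmax_ge0.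
by apply: cvgM; [exact: cvg_cst|exact: softmax_continuous].
Qed.

(** The threshold is 6 r, where r = e^(-(j + 1)) is the spacing of the net, and the rate c of scale
    j satisfies 2 c r = b (j + 1). *)
Lemma far_scale_term j x y : expR (ln 6 - j.+1%:R) < mdist x y ->
  scale_weight j * scale_kernel j x y <= expR (- j.+1%:R).
Proof.
move=> xy.
have far : scale_kernel j x y <= expR (2 * D * j.+1%:R) * expR (- (b * j.+1%:R)).
  apply: le_trans (softmax_kernel_far (r := expR (- j.+1%:R)) _ _ _) _ => //.
    by rewrite (le_lt_trans _ xy)// expRD lnK ?posrE.
  apply: ler_pM; rewrite ?expR_ge0//.
    rewrite (le_trans (net_size _))// ler_expR -mulrA mulrCA ler_wpM2l//.
    by rewrite -!natr1; have : (0 : R) <= j%:R by []; lra.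
  rewrite ler_expR lerN2 /scale_rate expRN le_eqVlt; apply/orP; left; apply/eqP.
  by field; rewrite gt_eqF ?expR_gt0.
have weight_le : scale_weight j <= expR (alpha * j.+1%:R).
  rewrite lerBlDr (@le_trans _ _ (expR (alpha * j.+1%:R)))//; last first.
    by rewrite lerDl powR_ge0.
  rewrite /powR gt_eqF// ler_expR ler_wpM2l ?(ltW alpha_gt0)//.
  by rewrite -[leRHS]expRK ler_ln ?posrE ?expR_gt0// (le_trans _ (expR_ge1Dx _))// lerDr.
apply: (le_trans (ler_pM _ _ weight_le far)).
- exact: scale_weight_ge0.
- exact: softmax_kernel_ge0.
by rewrite -!expRD ler_expR /b le_eqVlt; apply/orP; left; apply/eqP; ring.
Qed.

(** Scales j < t are bounded by their weights, which add up to at most t^alpha; for the others x and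
    y are far apart, and these contribute at most 1 altogether. *)
Lemma log_family_kernel_le T x y :
  feature_kernel (log_family T) x y <= (log_cutoff T x y + ln 6) `^ alpha + 1.
Proof.
have ln6 : (0 : R) <= ln 6 by apply: ln_ge0; lra.
have l0 := log_cutoff_ge0 T x y.
pose t := Num.truncn (log_cutoff T x y + ln 6).
have t_le : t%:R <= log_cutoff T x y + ln 6 by rewrite truncn_le addr_ge0.
rewrite log_family_kernel (bigID (fun j : 'I_T => (j < t)%N))/= lerD//.
  apply: (@le_trans _ _ (t%:R `^ alpha)); last first.
    by rewrite ge0_ler_powR ?nnegrE ?addr_ge0 ?(ltW alpha_gt0).
  apply: (@le_trans _ _ ((minn T t)%:R `^ alpha)); last first.
    by rewrite ge0_ler_powR ?nnegrE ?(ltW alpha_gt0)// ler_nat geq_minr.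
  rewrite -sum_scale_weight; apply: ler_sum => j _.
  by rewrite ler_piMr ?scale_weight_ge0// softmax_kernel_le1.
apply: le_trans (sum_expRN_le1 T); rewrite big_mkcond; apply: ler_sum => j _.
case: ifPn => [|_]; last exact: expR_ge0.
rewrite -leqNgt => tj; apply: far_scale_term.
rewrite ltNge; apply/negP => xy.
have : j.+1%:R - ln 6 <= log_cutoff T x y.
  apply: le_log_cutoff; first by rewrite opprB.
  by rewrite (@le_trans _ _ j.+1%:R)// ?ler_nat// lerBlDr lerDl.
rewrite lerBlDr => /(le_lt_trans)/(_ (truncnS_gt _)); rewrite ltr_nat.
by rewrite ltnS ltnNge tj.
Qed.

Lemma log_family_upper (d : R) : 0 < d -> exists C : R, 0 <= C /\
  forall T x y, feature_kernel (log_family T) x y <= (1 + d) * log_cutoff T x y `^ alpha + C.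
Proof.
move=> d0; have [C [C0 HC]] := powR_add_le alpha_gt0 d0.
have ln6 : (0 : R) <= ln 6 by apply: ln_ge0; lra.
exists (C * (ln 6) `^ alpha + 1); split=> [|T x y].
  by rewrite addr_ge0// mulr_ge0 ?powR_ge0.
rewrite (le_trans (log_family_kernel_le _ _ _))// addrA lerD2r HC//.
exact: log_cutoff_ge0.
Qed.

(** Let l be the truncated logarithm and th < 1. The scales j < th l hardly separate x and y: the
    exponent 2 c d(x, y) in [softmax_kernel_near] is at most b l e^(-(1 - th) l), which is small for
    large l. Their weights add up to about (th l)^alpha. *)
Lemma log_family_lower (d : R) : 0 < d -> exists C : R, 0 <= C /\
  forall T x y, log_cutoff T x y `^ alpha <= (1 + d) * feature_kernel (log_family T) x y + C.
Proof.
move=> d0; have d1 : 0 < 1 + d by rewrite addr_gt0.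
(* Three factors k are lost: the scale kernels are only at least 1 / k, th^(-alpha) is k, and l is
   compared with (m + 1) / th instead of m / th. *)
have [k [k1 k3]] : exists k : R, 1 < k /\ k ^+ 3 = 1 + d.
  exists ((1 + d) `^ 3^-1); split.
    by rewrite /powR gt_eqF// -[ltLHS]expR0 ltr_expR mulr_gt0 ?ln_gt0 ?ltrDl.
  by rewrite -powR_mulrn ?powR_ge0// -powRrM mulVf// powRr1// ltW.
have k0 : 0 < k by exact: lt_trans k1.
pose th := k `^ (- alpha^-1).
have th0 : 0 < th by exact: powR_gt0.
have th1 : th < 1.
  rewrite /th /powR gt_eqF// -[ltRHS]expR0 ltr_expR pmulr_llt0 ?ln_gt0//.
  by rewrite oppr_lt0 invr_gt0.
have thE : th^-1 `^ alpha = k.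
  rewrite -powR_inv1 ?(ltW th0)// -!powRrM.
  rewrite (_ : _ * _ = 1) ?powRr1 ?(ltW k0)//.
  by field; rewrite gt_eqF.
have e0 : 0 < k - 1 by rewrite subr_gt0.
have [C [C0 HC]] := powR_add_le alpha_gt0 e0.
pose c := 1 - th; have c0 : 0 < c by rewrite subr_gt0.
have lnk : 0 < ln k by exact: ln_gt0.
(* For l > l0, [mul_expRN_le] gives b l e^(-c l) <= 4 b / (c^2 l) <= ln k. Smaller l go into the
   additive constant. *)
pose l0 := b * 4 / c ^+ 2 / ln k.
have l0_gt0 : 0 < l0 by rewrite !divr_gt0 ?mulr_gt0 ?exprn_gt0.
exists (k * C + l0 `^ alpha); split=> [|T x y].
  by rewrite addr_ge0 ?powR_ge0// mulr_ge0// ltW.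
set l := log_cutoff T x y.
have kernel_ge0 : 0 <= feature_kernel (log_family T) x y.
  rewrite log_family_kernel; apply: sumr_ge0 => j _.
  by rewrite mulr_ge0 ?scale_weight_ge0// softmax_kernel_ge0.
have [ll0|l0l] := leP l l0.
  rewrite addrA; apply: (@le_trans _ _ (l0 `^ alpha)).
    by rewrite ge0_ler_powR ?nnegrE ?log_cutoff_ge0// ltW.
  by rewrite lerDr addr_ge0// mulr_ge0// ltW.
have l_gt0 : 0 < l by exact: lt_trans l0l.
pose m := Num.truncn (th * l).
have /andP[m1 m2] := truncn_itv (mulr_ge0 (ltW th0) (ltW l_gt0)).
rewrite -/m in m1 m2.
have mT : (m <= T)%N.
  rewrite -(ler_nat R) (le_trans m1)// (le_trans _ (log_cutoff_le T x y))//.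
  by rewrite ger_pMl// ltW.
have near_scale j : (j < m)%N -> k^-1 <= scale_kernel j x y.
  move=> jm; apply: le_trans (softmax_kernel_near _ _ _ _) => //.
  rewrite -[k]lnK ?posrE// -expRN ler_expR lerN2.
  have jl : j.+1%:R <= th * l by rewrite (le_trans _ m1)// ler_nat.
  have dl := mdist_le_log_cutoff l_gt0; rewrite -/l in dl.
  apply: (@le_trans _ _ (b * (l * expR (- (c * l))))).
    have -> : 2 * scale_rate j * mdist x y = b * (j.+1%:R * (expR j.+1%:R * mdist x y)).
      by rewrite /scale_rate; field.
    rewrite ler_wpM2l ?(ltW b_gt0)// ler_pM// ?mulr_ge0 ?expR_ge0 ?mdist_ge0//.
      by rewrite (le_trans jl)// ger_pMl// ltW.
    rewrite (_ : - (c * l) = th * l - l) ?expRD; last by rewrite /c; ring.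
    by rewrite ler_pM ?expR_ge0 ?mdist_ge0// ler_expR.
  apply: (@le_trans _ _ (b * (4 / (c ^+ 2 * l)))).
    by rewrite ler_wpM2l ?(ltW b_gt0)// mul_expRN_le.
  rewrite (_ : b * _ = l0 * ln k / l); last first.
    by rewrite /l0; field; rewrite !gt_eqF.
  by rewrite ler_pdivrMr// mulrC ler_pM2l// ltW.
have m_kernel : m%:R `^ alpha <= k * feature_kernel (log_family T) x y.
  rewrite -[m in leLHS](minn_idPr mT) -sum_scale_weight log_family_kernel.
  rewrite mulr_sumr big_mkcond; apply: ler_sum => j _.
  case: ifPn => [jm|_]; last first.
    by rewrite !mulr_ge0 ?(ltW k0) ?scale_weight_ge0// softmax_kernel_ge0.
  rewrite mulrCA ler_peMr ?scale_weight_ge0//.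
  by rewrite mulrC -ler_pdivrMr// mul1r near_scale.
have lm : l <= th^-1 * (m%:R + 1) by rewrite mulrC ler_pdivlMr// mulrC natr1 ltW.
apply: (@le_trans _ _ ((th^-1 * (m%:R + 1)) `^ alpha)).
  rewrite ge0_ler_powR ?nnegrE ?(ltW alpha_gt0) ?(ltW l_gt0)//.
  by rewrite mulr_ge0 ?addr_ge0 ?invr_ge0// ltW.
rewrite powRM ?invr_ge0 ?(ltW th0) ?addr_ge0// thE.
have := HC m%:R 1 (ler0n _ _) ler01; rewrite powR1 mulr1 (_ : 1 + (k - 1) = k); last by ring.
move=> HCm.
apply: (@le_trans _ _ (k * (k * m%:R `^ alpha + C))).
  by rewrite ler_wpM2l ?(ltW k0).
rewrite mulrDr addrA -k3 (_ : k ^+ 3 = k * (k * k)) ?exprSr ?expr0 ?mul1r ?mulrA//.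
rewrite -[leLHS]addr0 lerD ?powR_ge0// lerD2r -!mulrA ler_wpM2l ?(ltW k0)//.
by rewrite ler_wpM2l ?(ltW k0).
Qed.

End log_kernel.

(** * The outer measure of a positive functional *)

Section riesz.
Context {R : realType} {M : pmetricType R}.
Variable L : (M -> R) -> R.
Hypothesis M_compact : compact [set: M].
Hypothesis L_cst : forall c : R, L (cst c) = c.
Hypothesis L_le : forall phi psi : M -> R, continuous phi -> continuous psi ->
  (forall x, phi x <= psi x) -> L phi <= L psi.
Hypothesis L_add : forall phi psi : M -> R, continuous phi -> continuous psi ->
  L (fun x => phi x + psi x) = L phi + L psi.

Definition subordinate (U : set M) : set (M -> R) :=
  [set phi : M -> R | [/\ continuous phi, forall x, 0 <= phi x <= 1 &
    forall x, ~ U x -> phi x = 0]].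

Definition open_content (U : set M) : \bar R :=
  ereal_sup [set (L phi)%:E | phi in subordinate U].

Definition riesz_outer (A : set M) : \bar R :=
  ereal_inf [set open_content U | U in [set U | open U /\ A `<=` U]].

(** Makes up for the absence of a support condition in [subordinate]: the result vanishes outside
    the closed set where phi >= e, which is compact and contained in U when phi is subordinate to U,
    and L decreases by at most e. *)
Definition shave (e : R) (phi : M -> R) (x : M) : R := Num.max (phi x - e) 0.

Lemma shave_continuous e phi : continuous phi -> continuous (shave e phi).
Proof.
move=> phi_cont x.
have h1 : {for x, continuous (fun x => phi x - e : R^o)}.
  by apply: cvgB; [exact: phi_cont|exact: cvg_cst].
exact: (@continuous_max _ _ _ (cst 0) x h1 (@cst_continuous _ _ _ x)).
Qed.

Lemma shave_range e phi x : 0 <= e -> 0 <= phi x <= 1 -> 0 <= shave e phi x <= 1.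
Proof.
move=> e0 /andP[p0 p1]; rewrite le_max lexx orbT/= ge_max ler01 andbT.
by rewrite lerBlDr (le_trans p1)// lerDl.
Qed.

Lemma shave_eq0 e phi x : phi x <= e -> shave e phi x = 0.
Proof. by move=> pe; apply/max_idPr; rewrite subr_le0. Qed.

Lemma le_L_shave e phi : continuous phi -> L phi <= L (shave e phi) + e.
Proof.
move=> phi_cont; rewrite -[X in _ + X]L_cst -L_add; last 2 first.
- exact: shave_continuous.
- exact: cst_continuous.
apply: L_le => //.
  by move=> x; apply: cvgD; [exact: shave_continuous|exact: cvg_cst].
by move=> x /=; rewrite -lerBlDr le_max lexx.
Qed.

Lemma subordinate0 U : subordinate U (cst 0).
Proof. by split => // x; [exact: cvg_cst|rewrite lexx ler01]. Qed.

Lemma open_content_ub U phi : subordinate U phi -> ((L phi)%:E <= open_content U)%E.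
Proof. by move=> pU; apply: ereal_sup_ubound; exists phi. Qed.

Lemma open_content_ge0 U : (0 <= open_content U)%E.
Proof. by have := open_content_ub (subordinate0 U); rewrite L_cst. Qed.

Lemma open_content_le1 U : (open_content U <= 1)%E.
Proof.
apply: ge_ereal_sup => _ [phi [phi_cont phi01 _] <-].
rewrite lee_fin -(L_cst 1); apply: L_le => //; first exact: cst_continuous.
by move=> x; have /andP[] := phi01 x.
Qed.

Lemma open_content_fin U : open_content U \is a fin_num.
Proof.
rewrite ge0_fin_numE ?open_content_ge0//.
by rewrite (le_lt_trans (open_content_le1 U))// ltry.
Qed.

Lemma open_content_approx U (e : R) : 0 < e ->
  exists2 phi, subordinate U phi & (open_content U <= (L phi + e)%:E)%E.
Proof.
move=> e0; have [_ [phi pU <-] /ltW le] := ub_ereal_sup_adherent e0 (open_content_fin U).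
by exists phi => //; rewrite EFinD -leeBlDr.
Qed.

Lemma le_open_content U V : U `<=` V -> (open_content U <= open_content V)%E.
Proof.
move=> UV; apply: ge_ereal_sup => _ [phi [phi_cont phi01 phi0] <-].
by apply: open_content_ub; split => // x nVx; apply: phi0 => /UV.
Qed.

Lemma open_content0 : open_content set0 = 0%E.
Proof.
apply/eqP; rewrite eq_le open_content_ge0 andbT.
apply: ge_ereal_sup => _ [phi [phi_cont phi01 phi0] <-].
by rewrite (_ : phi = cst 0) ?L_cst//; apply/funext => x; exact: phi0.
Qed.

Lemma open_contentT : open_content setT = 1%E.
Proof.
apply/eqP; rewrite eq_le open_content_le1/= -(L_cst 1); apply: open_content_ub.
by split => // x; [exact: cvg_cst|rewrite /= lexx ler01|case].
Qed.

Lemma closed_superlevel (e : R) (phi : M -> R) : continuous phi ->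
  closed [set x | e <= phi x].
Proof.
move=> phi_cont; apply: (@preimage_closed _ _ phi [set y | e <= y]).
  by move=> x _; exact: phi_cont.
exact: closed_ge.
Qed.

(** A Urysohn function u, equal to 0 off U and to 1 on the part of the set phi >= e lying off V,
    splits the shaved phi into a part subordinate to U and a part subordinate to V. *)
Lemma open_contentU U V : open U -> open V ->
  (open_content (U `|` V) <= open_content U + open_content V)%E.
Proof.
move=> oU oV; apply: ge_ereal_sup => _ [phi [phi_cont phi01 phi0] <-].
apply/lee_addgt0Pr => e e0.
pose K := [set x | e <= phi x] `\` V.
have cK : closed K.
  by apply: closedI; [exact: closed_superlevel|exact: open_closedC].
have KU : ~` U `&` K = set0.
  rewrite -subset0 => x [/= nUx [/= ex nVx]].
  have : phi x = 0 by apply: phi0 => -[].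
  by move=> p0; move: ex; rewrite p0 leNgt e0.
have [u [u_cont u0 u1 u01]] := urysohn_ext_itv (pseudometric_normal (R := R))
  (open_closedC oU) cK KU (@ltr01 R).
have {}u01 x : 0 <= u x <= 1 by have /u01 : range u (u x) by []; rewrite /= in_itv.
pose p1 x := shave e phi x * u x; pose p2 x := shave e phi x * (1 - u x).
have p1c : continuous p1.
  by move=> x; apply: cvgM; [exact: shave_continuous|exact: u_cont].
have p2c : continuous p2.
  move=> x; apply: cvgM; first exact: shave_continuous.
  by apply: cvgB; [exact: cvg_cst|exact: u_cont].
have shave01 x : 0 <= shave e phi x <= 1 by rewrite shave_range// ltW.
have p1U : subordinate U p1.
  split => // x; rewrite /p1.
    have /andP[s0 s1] := shave01 x; have /andP[v0 v1] := u01 x.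
    by rewrite mulr_ge0//= mulr_ile1.
  by move=> nUx; rewrite (_ : u x = 0) ?mulr0//; apply: u0; exists x.
have p2V : subordinate V p2.
  split => // x; rewrite /p2.
    have /andP[s0 s1] := shave01 x; have /andP[v0 v1] := u01 x.
    by rewrite mulr_ge0 ?subr_ge0//= mulr_ile1 ?subr_ge0// lerBlDr lerDl.
  move=> nVx; have [ep|pe] := leP e (phi x); last by rewrite shave_eq0 ?mul0r// ltW.
  rewrite (_ : u x = 1) ?subrr ?mulr0//; apply: u1; exists x => //.
apply: (@le_trans _ _ ((L p1)%:E + (L p2)%:E + e%:E)%E).
  rewrite -!EFinD lee_fin -L_add//.
  rewrite (_ : (fun x => p1 x + p2 x) = shave e phi) ?le_L_shave//.
  by apply/funext => x; rewrite /p1 /p2; ring.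
by rewrite leeD2r// leeD// open_content_ub.
Qed.

Lemma open_content_bigsetU (U : nat -> set M) n : (forall i, open (U i)) ->
  (open_content (\big[setU/set0]_(i < n) U i) <= \sum_(i < n) open_content (U i))%E.
Proof.
move=> oU; elim: n => [|n IH]; first by rewrite !big_ord0 open_content0.
rewrite !big_ord_recr/= (le_trans (open_contentU _ _))// ?leeD2r//.
by rewrite -bigcup_mkord; apply: bigcup_open => i _.
Qed.

(** The set phi >= e is compact, so finitely many of the U i already carry the shaved phi. *)
Lemma open_content_bigcup (U : nat -> set M) : (forall i, open (U i)) ->
  (open_content (\bigcup_i U i) <= \sum_(i <oo) open_content (U i))%E.
Proof.
move=> oU; apply: ge_ereal_sup => _ [phi [phi_cont phi01 phi0] <-].
apply/lee_addgt0Pr => e e0.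
have K_compact : compact [set x | e <= phi x].
  by apply: subclosed_compact M_compact _ => //; exact: closed_superlevel.
move: K_compact; rewrite compact_cover => /(_ nat setT U) [].
- by move=> i _; exact: oU.
- move=> x /= ex; apply: contrapT => nUx; move: ex.
  by rewrite phi0 ?leNgt ?e0// => -[i _ Uix]; apply: nUx; exists i.
move=> D _ KD; pose n := (\max_(i <- enum_fset D) i).+1.
have sub : subordinate (\big[setU/set0]_(i < n) U i) (shave e phi).
  split; first exact: shave_continuous.
    by move=> x; rewrite shave_range// ltW.
  move=> x nUx; apply: shave_eq0; rewrite leNgt; apply/negP => /ltW/KD[i iD Uix].
  apply: nUx; rewrite -bigcup_mkord; exists i => //=.
  by rewrite /n ltnS; apply: leq_bigmax_seq.
apply: (@le_trans _ _ ((L (shave e phi))%:E + e%:E)%E).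
  by rewrite -EFinD lee_fin le_L_shave.
rewrite leeD2r// (le_trans (open_content_ub sub))//.
rewrite (le_trans (open_content_bigsetU _ _))// -(big_mkord xpredT (open_content \o U)).
by apply: nneseries_lim_ge => i _ _; exact: open_content_ge0.
Qed.

Lemma riesz_outer_open U : open U -> riesz_outer U = open_content U.
Proof.
move=> oU; apply/eqP; rewrite eq_le; apply/andP; split.
  by apply: ereal_inf_lbound; exists U => //; split.
by apply: le_ereal_inf_tmp => _ [V [oV UV] <-]; exact: le_open_content.
Qed.

Lemma riesz_outer_ge0 A : (0 <= riesz_outer A)%E.
Proof.
by apply: le_ereal_inf_tmp => _ [V [oV UV] <-]; exact: open_content_ge0.
Qed.

Lemma riesz_outer_le A B : A `<=` B -> (riesz_outer A <= riesz_outer B)%E.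
Proof.
move=> AB; apply: le_ereal_inf_tmp => _ [V [oV BV] <-].
by apply: ereal_inf_lbound; exists V => //; split => //; exact: subset_trans BV.
Qed.

Lemma riesz_outer_fin A : riesz_outer A \is a fin_num.
Proof.
rewrite ge0_fin_numE ?riesz_outer_ge0// (@le_lt_trans _ _ 1%E) ?ltry//.
rewrite -open_contentT -riesz_outer_open; last exact: openT.
exact: riesz_outer_le.
Qed.

Lemma riesz_outer_approx A (e : R) : 0 < e -> exists U, [/\ open U, A `<=` U &
  (open_content U <= riesz_outer A + e%:E)%E].
Proof.
move=> e0; have [_ [U [oU AU] <-] /ltW le] := lb_ereal_inf_adherent e0 (riesz_outer_fin A).
by exists U.
Qed.

Lemma riesz_outer0 : riesz_outer set0 = 0%E.
Proof. by rewrite riesz_outer_open ?open_content0//; exact: open0. Qed.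

Lemma riesz_outer_sigma_subadditive : sigma_subadditive riesz_outer.
Proof.
move=> F; apply/lee_addgt0Pr => e e0.
have /choice[U UF] : forall n, exists U, [/\ open U, F n `<=` U &
    (open_content U <= riesz_outer (F n) + (e / (2 ^ n.+1)%:R)%:E)%E].
  by move=> n; apply: riesz_outer_approx; rewrite divr_gt0// ltr0n expn_gt0.
apply: le_trans (epsilon_trick _ _ (ltW e0)); last first.
  by move=> n; exact: riesz_outer_ge0.
apply: (@le_trans _ _ (open_content (\bigcup_n U n))).
  apply: ereal_inf_lbound; exists (\bigcup_n U n) => //; split.
    by apply: bigcup_open => n _; have [] := UF n.
  by apply: subset_bigcup => n _; have [] := UF n.
apply: (le_trans (open_content_bigcup _)) => [n|]; first by have [] := UF n.
apply: lee_nneseries => n *; first exact: open_content_ge0.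
by have [] := UF n.
Qed.

HB.instance Definition _ := isOuterMeasure.Build R M riesz_outer
  riesz_outer0 riesz_outer_ge0 riesz_outer_le riesz_outer_sigma_subadditive.

(** Inside an almost optimal open A containing X, take phi almost optimal for A [&] U, then psi
    almost optimal for the part V of A where phi < e / 4. V contains X minus U, and the shaved phi
    and psi are never both nonzero, so their sum is subordinate to A. *)
Lemma open_caratheodory U : open U -> caratheodory_measurable riesz_outer U.
Proof.
move=> oU; apply: (@le_caratheodory_measurable _ _ riesz_outer) => X.
apply/lee_addgt0Pr => e e0.
(* Four errors: the choices of A, phi and psi, and the shaving of phi. *)
have e2 : 0 < e / 4 by rewrite divr_gt0.
have [A [oA XA Ale]] := riesz_outer_approx X e2.
have [phi pAU phi_sup] := open_content_approx (A `&` U) e2.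
have [phi_cont phi01 phi0] := pAU.
pose V := A `\` [set x | e / 4 <= phi x].
have oV : open V.
  by apply: openI => //; apply: closed_openC; exact: closed_superlevel.
have [psi [psi_cont psi01 psi0] psi_sup] := open_content_approx V e2.
pose sum x := shave (e / 4) phi x + psi x.
have sumA : subordinate A sum.
  split => [x|x|x nAx].
  - by apply: cvgD; [exact: shave_continuous|exact: psi_cont].
  - have [p|p] := leP (phi x) (e / 4); rewrite /sum.
      by rewrite shave_eq0 ?add0r.
    by rewrite psi0 ?addr0 ?shave_range ?(ltW e2)// => -[_]; apply; exact: ltW.
  - rewrite /sum psi0 => [|[]//]; rewrite addr0 shave_eq0// phi0 ?(ltW e2)// => -[]//.
have hU : (riesz_outer (X `&` U) <= open_content (A `&` U))%E.
  apply: ereal_inf_lbound; exists (A `&` U) => //; split; first exact: openI.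
  exact: setSI.
have hV : (riesz_outer (X `&` ~` U) <= open_content V)%E.
  apply: ereal_inf_lbound; exists V => //; split => // x [Xx nUx]; split; first exact: XA.
  by rewrite /= phi0 ?leNgt ?e2// => -[].
have hs := open_content_ub sumA.
have Lsum : L phi + L psi - e / 4 <= L sum.
  rewrite /sum L_add//; last exact: shave_continuous.
  by have := le_L_shave (e / 4) phi_cont; lra.
change (riesz_outer (X `&` U) + riesz_outer (X `&` ~` U) <= riesz_outer X + e%:E)%E.
move: hU hV hs Ale phi_sup psi_sup.
rewrite -(fineK (open_content_fin (A `&` U))) -(fineK (open_content_fin V)).
rewrite -(fineK (open_content_fin A)) -(fineK (riesz_outer_fin (X `&` U))).
rewrite -(fineK (riesz_outer_fin (X `&` ~` U))) -(fineK (riesz_outer_fin X)).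
by rewrite -!EFinD !lee_fin => *; lra.
Qed.

Lemma borel_caratheodory (B : set (borelType M)) : measurable B ->
  caratheodory_measurable riesz_outer B.
Proof.
apply: smallest_sub; last by move=> U oU; exact: open_caratheodory.
split.
- exact: (caratheodory_measurable_set0 riesz_outer).
- move=> A mA; rewrite setTD.
  exact: (@caratheodory_measurable_setC _ _ riesz_outer).
- move=> A mA; exact: (@caratheodory_measurable_bigcup _ _ riesz_outer).
Qed.

Definition riesz_measure (B : set (borelType M)) : \bar R := riesz_outer B.

Lemma riesz_measure_sigma_additive : semi_sigma_additive riesz_measure.
Proof.
move=> F mF tF mUF.
apply: (@caratheodory_measure_sigma_additive R M riesz_outer) => //.
  by move=> n; exact: borel_caratheodory.
exact: borel_caratheodory.
Qed.

HB.instance Definition _ := isMeasure.Build _ _ _ riesz_measure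
  riesz_outer0 (fun B => riesz_outer_ge0 B) riesz_measure_sigma_additive.

Lemma riesz_measureT : riesz_measure setT = 1%E.
Proof. by rewrite /riesz_measure riesz_outer_open ?open_contentT//; exact: openT. Qed.

HB.instance Definition _ := Measure_isProbability.Build _ _ _ riesz_measure
  riesz_measureT.

Section invariance.
Variables f g : M -> M.
Hypotheses (f_cont : continuous f) (g_cont : continuous g).
Hypotheses (fK : cancel f g) (gK : cancel g f).
Hypothesis L_invariant : forall phi : M -> R, continuous phi ->
  (forall x, 0 <= phi x <= 1) -> L (phi \o f) = L phi.

(** Composition with f turns functions subordinate to U into functions subordinate to its preimage,
    and composition with g goes back; L has the same value on both. *)
Lemma open_content_preimage U : open_content (f @^-1` U) = open_content U.
Proof.
apply/eqP; rewrite eq_le; apply/andP; split.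
  apply: ge_ereal_sup => _ [phi [phi_cont phi01 phi0] <-].
  have pg_cont : continuous (phi \o g).
    by move=> x; apply: continuous_comp; [exact: g_cont|exact: phi_cont].
  have <- : L (phi \o g) = L phi.
    rewrite -(L_invariant pg_cont) => [|x]; last exact: phi01.
    by congr L; apply/funext => x /=; rewrite fK.
  apply: open_content_ub; split => // x; first exact: phi01.
  by move=> nUx; apply: phi0; rewrite /= gK.
apply: ge_ereal_sup => _ [phi [phi_cont phi01 phi0] <-].
rewrite -(L_invariant phi_cont phi01); apply: open_content_ub; split => x.
- by apply: continuous_comp; [exact: f_cont|exact: phi_cont].
- exact: phi01.
- by move=> nUx; exact: phi0.
Qed.

Lemma riesz_outer_preimage A : riesz_outer (f @^-1` A) = riesz_outer A.
Proof.
apply/eqP; rewrite eq_le; apply/andP; split.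
  apply: le_ereal_inf_tmp => _ [U [oU AU] <-]; rewrite -open_content_preimage.
  apply: ereal_inf_lbound; exists (f @^-1` U) => //; split.
    by apply: open_comp => // x _; exact: f_cont.
  by move=> x; exact: AU.
apply: le_ereal_inf_tmp => _ [U [oU AU] <-].
have -> : U = f @^-1` (g @^-1` U) by apply/seteqP; split => x /=; rewrite fK.
rewrite open_content_preimage; apply: ereal_inf_lbound.
exists (g @^-1` U) => //; split.
  by apply: open_comp => // x _; exact: g_cont.
by move=> x Ax; apply: AU; rewrite /= gK.
Qed.

End invariance.

(* The representation [L phi = \int phi] is not established: invariance only
   involves the values of L through those of the outer measure. *)
Lemma riesz_invariant : exists m : probability (borelType M) R,
  forall f g : M -> M, continuous f -> continuous g -> cancel f g -> cancel g f ->
  (forall phi : M -> R, continuous phi -> (forall x, 0 <= phi x <= 1) ->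
    L (phi \o f) = L phi) ->
  forall B, m (f @^-1` B) = m B.
Proof.
exists riesz_measure => f g fc gc fK gK Lf B; exact: (riesz_outer_preimage fc gc fK gK Lf).
Qed.

End riesz.

(** * Means of bounded functions and stationarity *)

Section bounded_mean.
Context d (T : measurableType d) (R : realType) (P : probability T R).
Implicit Types (phi psi : T -> R) (c : R).

Definition bounded_mfun phi : Prop :=
  measurable_fun setT phi /\ exists B : R, forall x, `|phi x| <= B.

Definition mean phi : R := (\int[P]_x phi x)%R.

Lemma bounded_mfun_integrable phi : bounded_mfun phi ->
  P.-integrable setT (EFin \o phi).
Proof.
move=> [mphi [B phiB]]; apply: measurable_bounded_integrable => //.
  by rewrite (le_lt_trans (probability_le1 P measurableT))// ltry.
exists B; split; first exact: num_real.
by move=> y By x _; apply: (le_trans (phiB x)); exact: ltW.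
Qed.

Lemma bounded_mfun_cst c : bounded_mfun (fun=> c).
Proof. by split; [exact: measurable_cst|exists `|c|]. Qed.

Lemma bounded_mfunD phi psi : bounded_mfun phi -> bounded_mfun psi ->
  bounded_mfun (fun x => phi x + psi x).
Proof.
move=> [mphi [B phiB]] [mpsi [C psiC]]; split; first exact: measurable_funD.
by exists (B + C) => x; rewrite (le_trans (ler_normD _ _))// lerD.
Qed.

Lemma bounded_mfunM phi psi : bounded_mfun phi -> bounded_mfun psi ->
  bounded_mfun (fun x => phi x * psi x).
Proof.
move=> [mphi [B phiB]] [mpsi [C psiC]]; split; first exact: measurable_funM.
by exists (B * C) => x; rewrite normrM ler_pM.
Qed.

Lemma bounded_mfunZ c phi : bounded_mfun phi -> bounded_mfun (fun x => c * phi x).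
Proof. by apply: bounded_mfunM; exact: bounded_mfun_cst. Qed.

Lemma bounded_mfunB phi psi : bounded_mfun phi -> bounded_mfun psi ->
  bounded_mfun (fun x => phi x - psi x).
Proof.
move=> bphi bpsi; rewrite (_ : (fun x => _) = (fun x => phi x + -1 * psi x)).
  by apply: bounded_mfunD => //; exact: bounded_mfunZ.
by apply/funext => x; rewrite mulN1r.
Qed.

Lemma bounded_mfunX phi n : bounded_mfun phi -> bounded_mfun (fun x => phi x ^+ n).
Proof.
move=> bphi; elim: n => [|n IH]; first exact: bounded_mfun_cst.
rewrite (_ : (fun x => _) = (fun x => phi x * phi x ^+ n)).
  exact: bounded_mfunM.
by apply/funext => x; rewrite exprS.
Qed.

Lemma bounded_mfun_sum (I : eqType) (s : seq I) (F : I -> T -> R) :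
  (forall i, i \in s -> bounded_mfun (F i)) ->
  bounded_mfun (fun x => \sum_(i <- s) F i x).
Proof.
elim: s => [|i s IH] Fb.
  rewrite (_ : (fun x => _) = (fun=> 0)); first exact: bounded_mfun_cst.
  by apply/funext => x; rewrite big_nil.
rewrite (_ : (fun x => _) = (fun x => F i x + \sum_(j <- s) F j x)).
  apply: bounded_mfunD; first by apply: Fb; rewrite mem_head.
  by apply: IH => j js; apply: Fb; rewrite in_cons js orbT.
by apply/funext => x; rewrite big_cons.
Qed.

Lemma bounded_mfun_indic (A : set T) : measurable A -> bounded_mfun (\1_A).
Proof.
move=> mA; split; first exact: measurable_indic.
by exists 1 => x; rewrite indicE; case: (_ \in _); rewrite ?normr1 ?normr0.
Qed.

Lemma mean_cst c : mean (fun=> c) = c.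
Proof.
rewrite /mean Rintegral_cst// -[RHS]mulr1; congr (_ * _).
by transitivity (fine (1%E : \bar R)); [congr fine; exact: probability_setT|].
Qed.

Lemma meanD phi psi : bounded_mfun phi -> bounded_mfun psi ->
  mean (fun x => phi x + psi x) = mean phi + mean psi.
Proof. by move=> *; rewrite /mean RintegralD//; exact: bounded_mfun_integrable. Qed.

Lemma meanZ c phi : bounded_mfun phi -> mean (fun x => c * phi x) = c * mean phi.
Proof. by move=> *; rewrite /mean RintegralZl//; exact: bounded_mfun_integrable. Qed.

Lemma mean_sum (I : eqType) (s : seq I) (F : I -> T -> R) :
  (forall i, i \in s -> bounded_mfun (F i)) ->
  mean (fun x => \sum_(i <- s) F i x) = \sum_(i <- s) mean (F i).
Proof.
elim: s => [|i s IH] Fb.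
  rewrite big_nil (_ : (fun x => _) = (fun=> 0)) ?mean_cst//.
  by apply/funext => x; rewrite big_nil.
have Fs j : j \in s -> bounded_mfun (F j).
  by move=> js; apply: Fb; rewrite in_cons js orbT.
rewrite big_cons (_ : (fun x => _) = (fun x => F i x + \sum_(j <- s) F j x)).
  rewrite meanD ?IH//; first by apply: Fb; rewrite mem_head.
  exact: bounded_mfun_sum.
by apply/funext => x; rewrite big_cons.
Qed.

Lemma mean_le phi psi : bounded_mfun phi -> bounded_mfun psi ->
  (forall x, phi x <= psi x) -> mean phi <= mean psi.
Proof. by move=> *; apply: le_Rintegral => //; exact: bounded_mfun_integrable. Qed.

Lemma mean_ge0 phi : (forall x, 0 <= phi x) -> 0 <= mean phi.
Proof. by move=> phi0; exact: Rintegral_ge0. Qed.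

Lemma mean_indic (A : set T) : measurable A -> mean (\1_A) = fine (P A).
Proof.
move=> mA; rewrite /mean /Rintegral; congr fine.
by rewrite integral_indic// setIT.
Qed.

Lemma meanE phi : bounded_mfun phi -> (mean phi)%:E = (\int[P]_x (phi x)%:E)%E.
Proof.
by move=> b; rewrite /mean /Rintegral fineK//; apply: integrable_fin_num => //;
  exact: bounded_mfun_integrable.
Qed.

Definition rank_kernel (l : seq ((T -> R) * (T -> R))) (x y : T) : R :=
  \sum_(p <- l) p.1 x * p.2 y.

(** The double integral of [rank_kernel], written as a finite sum of products of means. *)
Definition rank_form (l : seq ((T -> R) * (T -> R))) : R :=
  \sum_(p <- l) mean p.1 * mean p.2.

Definition bounded_rank (l : seq ((T -> R) * (T -> R))) : Prop :=
  forall p, p \in l -> bounded_mfun p.1 /\ bounded_mfun p.2.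

Lemma mean_rank_kernel l y : bounded_rank l ->
  mean (fun x => rank_kernel l x y) = \sum_(p <- l) mean p.1 * p.2 y.
Proof.
move=> bl.
have -> : (fun x => rank_kernel l x y) = (fun x => \sum_(p <- l) p.2 y * p.1 x).
  by apply/funext => x; apply: eq_bigr => p _; rewrite mulrC.
rewrite mean_sum => [|p pl]; last by apply: bounded_mfunZ; have [] := bl p pl.
rewrite big_seq [RHS]big_seq; apply: eq_bigr => p pl.
by rewrite meanZ; [rewrite mulrC|have [] := bl p pl].
Qed.

(** The inequality is integrated in x for each y, then in y. All comparisons of energies reduce to
    pointwise inequalities between kernels in this way. *)
Lemma rank_form_le l1 l2 : bounded_rank l1 -> bounded_rank l2 ->
  (forall x y, rank_kernel l1 x y <= rank_kernel l2 x y) ->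
  rank_form l1 <= rank_form l2.
Proof.
have formE l : bounded_rank l ->
    rank_form l = mean (fun y => \sum_(p <- l) mean p.1 * p.2 y).
  move=> bl; rewrite mean_sum => [|p pl]; last by apply: bounded_mfunZ; have [] := bl p pl.
  rewrite /rank_form big_seq [RHS]big_seq; apply: eq_bigr => p pl.
  by rewrite meanZ; last have [] := bl p pl.
have bsum l : bounded_rank l -> bounded_mfun (fun y => \sum_(p <- l) mean p.1 * p.2 y).
  by move=> bl; apply: bounded_mfun_sum => p pl; apply: bounded_mfunZ; have [] := bl p pl.
have bker l y : bounded_rank l -> bounded_mfun (fun x => rank_kernel l x y).
  move=> bl; apply: bounded_mfun_sum => p pl.
  by have [b1 b2] := bl p pl; apply: bounded_mfunM => //; exact: bounded_mfun_cst.
move=> b1 b2 le; rewrite !formE//; apply: mean_le; [exact: bsum|exact: bsum|].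
by move=> y; rewrite -!mean_rank_kernel//; apply: mean_le => //; exact: bker.
Qed.

End bounded_mean.

(** * Borel functions on M and on the space of bi-Lipschitz maps *)

Section borel_maps.
Context {R : realType}.

Lemma continuous_borel_measurable (M : pmetricType R) (phi : M -> R) :
  continuous phi -> measurable_fun [set: borelType M] phi.
Proof.
move=> /continuousP phi_cont; apply: (measurability _ (RGenOpens.measurableE R)).
move=> _ [_ [a [b ->] <-]]; rewrite setTI; apply: sub_sigma_algebra.
exact/phi_cont/interval_open.
Qed.

Lemma superlevel_open_measurable (X : ptopologicalType) (h : X -> R) :
  (forall c, open [set x | c < h x]) -> measurable_fun [set: borelType X] h.
Proof.
move=> oh; apply: (measurability _ (RGenOInfty.measurableE R)).
move=> _ [_ [a ->] <-]; rewrite setTI; apply: sub_sigma_algebra.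
rewrite (_ : _ @^-1` _ = [set x | a < h x]); first exact: oh.
by apply/seteqP; split => x /=; rewrite in_itv/= andbT.
Qed.

Variable M : pmetricType R.
Hypothesis M_compact : compact [set: M].

Lemma continuous_bounded (phi : M -> R) : continuous phi ->
  exists B : R, 0 < B /\ forall x, `|phi x| <= B.
Proof.
move=> phi_cont.
have /compact_bounded[B [_ HB]] : compact (phi @` [set: M]).
  by apply: continuous_compact => //; exact: continuous_subspaceT.
exists (`|B| + 1); split => [|x]; first by rewrite ltr_wpDl.
by apply: HB; [rewrite ltr_pwDr// ler_norm|exists x].
Qed.

Lemma continuous_bounded_mfun (phi : M -> R) :
  continuous phi -> bounded_mfun (phi : borelType M -> R).
Proof.
move=> phi_cont; split; first exact: continuous_borel_measurable.
by have [B [_ HB]] := continuous_bounded phi_cont; exists B.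
Qed.

Lemma lipschitz_continuous (f : M -> M) (K : R) :
  (forall x y, mdist (f x) (f y) <= K * mdist x y) -> continuous f.
Proof.
move=> fK x; apply/metricType_numDomainType.cvgrPdist_lt => e e0.
have K1 : 0 < `|K| + 1 by rewrite ltr_wpDl.
near=> y; rewrite (le_lt_trans (fK _ _))// (@le_lt_trans _ _ ((`|K| + 1) * mdist x y))//.
  by rewrite ler_wpM2r ?mdist_ge0// (le_trans (ler_norm K))// lerDl.
rewrite -ltr_pdivlMl// mulrC.
suff : ball x (e / (`|K| + 1)) y by rewrite ballEmdist.
near: y; apply: nbhsx_ballx; by rewrite divr_gt0.
Unshelve. all: by end_near. Qed.

Lemma lipHomeo_continuous (f : lipHomeo M) : continuous f.
Proof. by have [K fK] := lip_fun_lipschitz f; exact: lipschitz_continuous fK. Qed.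

Lemma lip_inv_continuous (f : lipHomeo M) : continuous (lip_inv f).
Proof. by have [K fK] := lip_inv_lipschitz f; exact: lipschitz_continuous fK. Qed.

Lemma lipHomeo_open (A : set (lipHomeo M)) :
  (forall f, A f -> exists2 e : R, 0 < e &
    forall g : lipHomeo M, (forall x, mdist (f x) (g x) < e) -> A g) -> open A.
Proof.
move=> HA; rewrite openE => f Af; have [e e0 He] := HA f Af.
pose emb (h : lipHomeo M) : {uniform M -> M} := (h : M -> M).
have emb_cont : continuous emb by exact: initial_continuous.
pose N : set {uniform M -> M} := [set h | forall x, ball (f x) e (h x)].
have fN : nbhs (emb f) N.
  apply/uniform_nbhs; exists [set xy | ball xy.1 e xy.2]; split.
    exact: entourage_ball (PosNum e0).
  by move=> h fh x; exact: fh.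
have near_f : nbhs f (emb @^-1` N) := emb_cont f N fN.
apply: filterS near_f => g gN; apply: He => x.
by have := gN x; rewrite ballEmdist.
Qed.

End borel_maps.

(** * Dependence on f of the image measure of nu *)

Section stationary_mean.
Context {R : realType} {M : pmetricType R}.
Hypothesis M_compact : compact [set: M].
Variable nu : probability (borelType M) R.

Let open_measurable (U : set M) : open U -> measurable (U : set (borelType M)).
Proof. exact: sub_sigma_algebra. Qed.

Let preimage_measurable (f : lipHomeo M) (U : set M) : open U ->
  measurable (f @^-1` U : set (borelType M)).
Proof.
move=> oU; apply: open_measurable; apply: open_comp => // x _.
exact: lipHomeo_continuous.
Qed.

(** A map g uniformly closer to f than 1 / (m + 1) sends into U every point that f sends into this
    set. *)
Definition inner_set (U : set M) (m : nat) : set M :=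
  [set x | forall y, ~ U y -> m.+1%:R^-1 <= mdist x y].

Lemma inner_set_closed U m : closed (inner_set U m).
Proof.
rewrite (_ : inner_set U m =
    \bigcap_(y in ~` U) ((fun x => mdist x y) @^-1` [set r | m.+1%:R^-1 <= r])).
  apply: closed_bigI => y _; apply: preimage_closed => [x _|].
    exact: mdist_continuous.
  exact: closed_ge.
by apply/seteqP; split => x /= xU y; exact: xU.
Qed.

Lemma inner_set_homo U m p : (m <= p)%N -> inner_set U m `<=` inner_set U p.
Proof.
move=> mp x xm y nUy; rewrite (le_trans _ (xm y nUy))// lef_pV2 ?posrE//.
by rewrite ler_nat ltnS.
Qed.

Lemma bigcup_inner_set U : open U -> \bigcup_m inner_set U m = U.
Proof.
move=> oU; apply/seteqP; split => [x [m _ xm]|x Ux].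
  apply: contrapT => /xm; rewrite mdistxx leNgt invr_gt0 ltr0Sn //.
have /nbhs_ballP[e /= e0 xe] : nbhs x U by exact: open_nbhs_nbhs.
have [m me] : exists m : nat, m.+1%:R^-1 < e.
  exists (Num.truncn e^-1); rewrite invf_plt ?posrE//; exact: truncnS_gt.
exists m => // y nUy; rewrite leNgt; apply/negP => xy.
by apply: nUy; apply: xe; rewrite ballEmdist/= (lt_trans xy).
Qed.

Definition preimage_mass (U : set M) (f : lipHomeo M) : R :=
  fine (nu (f @^-1` U)).

Lemma mass_le (A B : set (borelType M)) : measurable A -> measurable B ->
  A `<=` B -> fine (nu A) <= fine (nu B).
Proof.
move=> mA mB AB; apply: fine_le; [exact: fin_num_measure|exact: fin_num_measure|].
exact: (le_measure nu (mem_set mA) (mem_set mB) AB).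
Qed.

(** If f^-1(U) has mass greater than c, so has the preimage of some inner set, by continuity from
    below; for g close to f, g^-1(U) contains that preimage. Borel measurability in f follows. *)
Lemma preimage_mass_semicontinuous U c : open U ->
  open [set f | c < preimage_mass U f].
Proof.
move=> oU; apply: lipHomeo_open => f /= cf.
have mF m : measurable (f @^-1` inner_set U m : set (borelType M)).
  rewrite -[X in measurable X]setCK; apply: measurableC; apply: open_measurable.
  rewrite preimage_setC; apply: open_comp => [x _|]; first exact: lipHomeo_continuous.
  exact/closed_openC/inner_set_closed.
have FE : \bigcup_m (f @^-1` inner_set U m) = f @^-1` U.
  by rewrite -preimage_bigcup bigcup_inner_set.
have [m cm] : exists m, c < fine (nu (f @^-1` inner_set U m)).
  apply: contrapT => /forallNP nc; move: cf; rewrite ltNge => /negP; apply.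
  rewrite -lee_fin /preimage_mass fineK ?fin_num_measure//; last exact: preimage_measurable.
  have mUF : measurable (\bigcup_m (f @^-1` inner_set U m) : set (borelType M)).
    by rewrite FE; exact: preimage_measurable.
  have ndF : nondecreasing_seq (fun m => f @^-1` inner_set U m).
    by move=> m p mp; apply/subsetPset => x; exact: inner_set_homo.
  have := nondecreasing_cvg_mu (mu := nu) mF mUF ndF; rewrite FE => /cvg_lim <- //.
  apply: lime_le.
    apply: ereal_nondecreasing_is_cvgn => m p mp.
    by apply: le_measure; [exact/mem_set|exact/mem_set|exact/subsetPset/ndF].
  apply: nearW => m /=; rewrite -(fineK (fin_num_measure nu _ (mF m))) lee_fin leNgt.
  by apply/negP; exact: nc.
exists (m.+1%:R^-1) => [|g fg]; first by rewrite invr_gt0.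
rewrite (lt_le_trans cm)//; apply: mass_le => //; first exact: preimage_measurable.
move=> x /= xm; apply: contrapT => /xm; rewrite leNgt => /negP; apply; exact: fg.
Qed.

Lemma bounded_mfun_preimage_mass U : open U ->
  bounded_mfun (preimage_mass U : borelType (lipHomeo M) -> R).
Proof.
move=> oU; split.
  by apply: superlevel_open_measurable => c; exact: preimage_mass_semicontinuous.
exists 1 => f; rewrite ger0_norm ?fine_ge0// -[leRHS]/(fine 1%E).
by rewrite fine_le ?fin_num_measure ?probability_le1//; exact: preimage_measurable.
Qed.

Definition orbit_mean (phi : M -> R) (f : lipHomeo M) : R := mean nu (phi \o f).

(** The sum counts the k < n with k < s; it is the ceiling of s. *)
Lemma count_levels (n : nat) (s : R) : 0 <= s <= n%:R ->
  s <= \sum_(k < n) (k%:R < s)%R%:R <= s + 1.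
Proof.
elim: n => [|n IH] /andP[s0 sn]; first by rewrite big_ord0 sn/= addr_ge0.
rewrite big_ord_recr/=; have [ns|sn'] := ltP n%:R s; last first.
  by rewrite addr0; apply: IH; rewrite s0.
rewrite (eq_bigr (fun=> 1)) => [|k _]; last first.
  by rewrite (lt_trans _ ns)// ltr_nat.
rewrite sumr_const card_ord natr1 sn/= -natr1 lerD2r ltW//.
Qed.

(** A discrete layer-cake formula: where 0 <= phi <= 1, this is phi rounded up to a multiple of 1 /
    (n + 1). The superlevel sets are open for continuous phi, so the masses of their preimages are
    measurable in f. *)
Definition level_approx (n : nat) (phi : M -> R) (x : M) : R :=
  n.+1%:R^-1 * \sum_(k < n.+1) \1_[set y | k%:R < n.+1%:R * phi y] x.

Lemma level_approxP n (phi : M -> R) x : 0 <= phi x <= 1 ->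
  phi x <= level_approx n phi x <= phi x + n.+1%:R^-1.
Proof.
move=> /andP[p0 p1]; have n0 : 0 < n.+1%:R :> R by [].
have := @count_levels n.+1 (n.+1%:R * phi x).
rewrite mulr_ge0// ler_piMr// => /(_ isT) /andP[le1 le2].
rewrite /level_approx; set S := \sum_(k < n.+1) _ in le1 le2 *.
set S' := (X in _ * X); have -> : S' = S.
  apply: eq_bigr => k _; rewrite indicE.
  suff -> : (x \in [set y | k%:R < n.+1%:R * phi y]) = (k%:R < n.+1%:R * phi x) by [].
  by apply/idP/idP; rewrite inE.
apply/andP; split; first by rewrite mulrC ler_pdivlMr// mulrC.
by rewrite mulrC ler_pdivrMr// mulrDl mulVf ?gt_eqF// mulrC.
Qed.

Lemma level_open n k (phi : M -> R) : continuous phi ->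
  open [set y | (k : nat)%:R < n.+1%:R * phi y].
Proof.
move=> phi_cont; apply: (@open_comp _ _ (fun y => n.+1%:R * phi y) [set r | k%:R < r]).
  by move=> y _; apply: cvgM; [exact: cvg_cst|exact: phi_cont].
exact: open_gt.
Qed.

Lemma bounded_level_approx n (phi : M -> R) : continuous phi ->
  bounded_mfun (level_approx n phi : borelType M -> R).
Proof.
move=> phi_cont; apply: bounded_mfunZ; apply: bounded_mfun_sum => k _.
by apply: bounded_mfun_indic; apply: open_measurable; exact: level_open.
Qed.

Lemma mean_level_approx n (phi : M -> R) : continuous phi ->
  mean nu (level_approx n phi) =
  n.+1%:R^-1 * \sum_(k < n.+1) fine (nu [set y | k%:R < n.+1%:R * phi y]).
Proof.
move=> phi_cont.
have mk k : measurable ([set y | k%:R < n.+1%:R * phi y] : set (borelType M)).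
  by apply: open_measurable; exact: level_open.
rewrite meanZ; last by apply: bounded_mfun_sum => k _; exact: bounded_mfun_indic.
by rewrite mean_sum => [|k _]; [under eq_bigr do rewrite mean_indic//|exact: bounded_mfun_indic].
Qed.

Lemma mean_level_approxP n (phi : M -> R) : continuous phi ->
  (forall x, 0 <= phi x <= 1) ->
  mean nu phi <= mean nu (level_approx n phi) <= mean nu phi + n.+1%:R^-1.
Proof.
move=> phi_cont phi01; have bphi := continuous_bounded_mfun M_compact phi_cont.
have bl := bounded_level_approx n phi_cont.
apply/andP; split; first by apply: mean_le => // x; have /andP[] := level_approxP n (phi01 x).
rewrite -[X in _ + X](mean_cst nu) -meanD//; last exact: bounded_mfun_cst.
apply: mean_le => //; first by apply: bounded_mfunD => //; exact: bounded_mfun_cst.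
by move=> x; have /andP[] := level_approxP n (phi01 x).
Qed.

End stationary_mean.

(** * Stationarity tested on continuous functions *)

Section stationary_identity.
Context {R : realType} {M : pmetricType R}.
Hypothesis M_compact : compact [set: M].
Variables (mu : probability (borelType (lipHomeo M)) R).
Variables (nu : probability (borelType M) R).

Definition level_mass n (phi : M -> R) (f : lipHomeo M) : R :=
  n.+1%:R^-1 * \sum_(k < n.+1) preimage_mass nu [set y | k%:R < n.+1%:R * phi y] f.

Lemma orbit_mean_approx n (phi : M -> R) : continuous phi ->
  (forall x, 0 <= phi x <= 1) -> forall f : lipHomeo M,
  orbit_mean nu phi f <= level_mass n phi f <= orbit_mean nu phi f + n.+1%:R^-1.
Proof.
move=> phi_cont phi01 f.
have pf_cont : continuous (phi \o f).
  by move=> x; apply: continuous_comp; [exact: lipHomeo_continuous|exact: phi_cont].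
have := mean_level_approxP M_compact nu n pf_cont (fun x => phi01 (f x)).
by rewrite mean_level_approx.
Qed.

Lemma bounded_mfun_level_mass n (phi : M -> R) : continuous phi ->
  bounded_mfun (level_mass n phi : borelType (lipHomeo M) -> R).
Proof.
move=> phi_cont; apply: bounded_mfunZ; apply: bounded_mfun_sum => k _.
by apply: bounded_mfun_preimage_mass => //; exact: level_open.
Qed.

(** A pointwise limit of the functions [level_mass n phi], which are finite combinations of lower
    semicontinuous functions of f. *)
Lemma bounded_mfun_orbit_mean01 (phi : M -> R) : continuous phi ->
  (forall x, 0 <= phi x <= 1) ->
  bounded_mfun (orbit_mean nu phi : borelType (lipHomeo M) -> R).
Proof.
move=> phi_cont phi01; split.
  apply: (@measurable_fun_cvg _ (borelType (lipHomeo M)) R setT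
    (fun n => level_mass n phi)).
    by move=> n; have [] := bounded_mfun_level_mass n phi_cont.
  move=> f _; apply: (@squeeze_cvgr _ _ _ _ (fun=> orbit_mean nu phi f)
      (fun n => orbit_mean nu phi f + n.+1%:R^-1)).
  - by apply: nearW => n; exact: orbit_mean_approx.
  - exact: cvg_cst.
  - rewrite -[X in _ --> X]addr0; apply: cvgD; first exact: cvg_cst.
    exact: cvg_harmonic.
have bf (f : lipHomeo M) : bounded_mfun (phi \o f : borelType M -> R).
  apply: continuous_bounded_mfun => // x.
  by apply: continuous_comp; [exact: lipHomeo_continuous|exact: phi_cont].
exists 1 => f; rewrite ger0_norm; last by apply: mean_ge0 => x /=; have /andP[] := phi01 (f x).
rewrite -[leRHS](mean_cst nu); apply: mean_le => //; first exact: bounded_mfun_cst.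
by move=> x; have /andP[] := phi01 (f x).
Qed.

Hypothesis nu_stationary : stationary mu nu.

Lemma stationary_open (U : set M) : open U ->
  mean mu (preimage_mass nu U) = fine (nu U).
Proof.
move=> oU; rewrite -(nu_stationary _) ; last exact: sub_sigma_algebra.
rewrite /mean /Rintegral /convolution; congr fine; apply: eq_integral => f _.
rewrite /preimage_mass fineK ?fin_num_measure//.
apply: sub_sigma_algebra; apply: open_comp => // x _; exact: lipHomeo_continuous.
Qed.

(** Both sides are within 1 / (n + 1) of averages over the superlevel sets of phi, and these
    averages agree by stationarity on open sets. *)
Lemma stationary_mean01 (phi : M -> R) : continuous phi ->
  (forall x, 0 <= phi x <= 1) -> mean nu phi = mean mu (orbit_mean nu phi).
Proof.
move=> phi_cont phi01; have bG := bounded_mfun_orbit_mean01 phi_cont phi01.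
suff near n : `|mean nu phi - mean mu (orbit_mean nu phi)| <= n.+1%:R^-1.
  apply/eqP; rewrite -subr_eq0 -normr_le0; apply/ler_addgt0Pr => e e0.
  rewrite add0r (le_trans (near (Num.truncn e^-1)))// ltW//.
  by rewrite invf_plt ?posrE//; exact: truncnS_gt.
have /andP[h1 h2] := mean_level_approxP M_compact nu n phi_cont phi01.
have bl := bounded_mfun_level_mass n phi_cont.
have E : mean nu (level_approx n phi) = mean mu (level_mass n phi).
  have bk k : bounded_mfun (preimage_mass nu [set y | (k : nat)%:R < n.+1%:R * phi y] :
      borelType (lipHomeo M) -> R).
    by apply: bounded_mfun_preimage_mass => //; exact: level_open.
  rewrite mean_level_approx// meanZ; last by apply: bounded_mfun_sum => k _; exact: bk.
  rewrite mean_sum => [|k _]; last exact: bk.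
  congr (_ * _); apply: eq_bigr => k _; rewrite stationary_open//.
  exact: level_open.
have approx := orbit_mean_approx n phi_cont phi01.
have h3 : mean mu (orbit_mean nu phi) <= mean nu (level_approx n phi).
  by rewrite E; apply: mean_le => // f; have /andP[] := approx f.
have h4 : mean nu (level_approx n phi) <= mean mu (orbit_mean nu phi) + n.+1%:R^-1.
  rewrite E -[X in _ + X](mean_cst mu) -meanD//; last exact: bounded_mfun_cst.
  apply: mean_le => //; first by apply: bounded_mfunD => //; exact: bounded_mfun_cst.
  by move=> f; have /andP[] := approx f.
by rewrite ler_distl (le_trans h1 h4) andbT lerBlDr (le_trans h3 h2).
Qed.

End stationary_identity.

Section stationary_nonneg.
Context {R : realType} {M : pmetricType R}.
Hypothesis M_compact : compact [set: M].
Variables (mu : probability (borelType (lipHomeo M)) R).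
Variables (nu : probability (borelType M) R).

Let normalize (phi : M -> R) : continuous phi -> (forall x, 0 <= phi x) ->
  exists B : R, [/\ 0 < B, continuous (fun x => B^-1 * phi x),
    forall x, 0 <= B^-1 * phi x <= 1 &
    orbit_mean nu phi = (fun f => B * orbit_mean nu (fun x => B^-1 * phi x) f)].
Proof.
move=> phi_cont phi0; have [B [B0 phiB]] := continuous_bounded M_compact phi_cont.
have psi_cont : continuous (fun x => B^-1 * phi x).
  by move=> x; apply: cvgM; [exact: cvg_cst|exact: phi_cont].
exists B; split => // [x|].
  rewrite mulr_ge0 ?invr_ge0 ?(ltW B0)//= mulrC ler_pdivrMr// mul1r.
  exact: le_trans (ler_norm _) (phiB x).
apply/funext => f; rewrite /orbit_mean -meanZ.
  by congr mean; apply/funext => x /=; rewrite mulrA divff ?mul1r ?gt_eqF.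
apply: continuous_bounded_mfun => // x.
by apply: continuous_comp; [exact: lipHomeo_continuous|exact: psi_cont].
Qed.

Lemma bounded_mfun_orbit_mean (phi : M -> R) : continuous phi ->
  (forall x, 0 <= phi x) ->
  bounded_mfun (orbit_mean nu phi : borelType (lipHomeo M) -> R).
Proof.
move=> phi_cont phi0; have [B [B0 psi_cont psi01 ->]] := normalize phi_cont phi0.
by apply: bounded_mfunZ; exact: bounded_mfun_orbit_mean01.
Qed.

Lemma stationary_mean (phi : M -> R) : stationary mu nu -> continuous phi ->
  (forall x, 0 <= phi x) -> mean mu (orbit_mean nu phi) = mean nu phi.
Proof.
move=> st phi_cont phi0; have [B [B0 psi_cont psi01 ->]] := normalize phi_cont phi0.
rewrite meanZ; last exact: bounded_mfun_orbit_mean01.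
rewrite -stationary_mean01// -meanZ; last exact: continuous_bounded_mfun.
by congr mean; apply/funext => x /=; rewrite mulrA divff ?mul1r ?gt_eqF.
Qed.

End stationary_nonneg.

(** * Energy of stationary measures *)

Section lip_const.
Context {R : realType} {M : pmetricType R}.
Implicit Types f : lipHomeo M.

(** The supremum of an empty or unbounded set is 0 by convention, hence the cases. *)
Lemma lip_seminorm_ge0 (f : M -> M) : 0 <= lip_seminorm f.
Proof.
rewrite /lip_seminorm; have [->|/set0P[r Sr]] := eqVneq
  [set r | exists x y : M, x != y /\ r = mdist (f x) (f y) / mdist x y] set0.
  by rewrite sup0.
have [ub|nub] := pselect (has_ubound
  [set r | exists x y : M, x != y /\ r = mdist (f x) (f y) / mdist x y]).
  apply: le_trans (ub_le_sup ub Sr); case: Sr => x [y [_ ->]].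
  by rewrite divr_ge0// mdist_ge0.
by rewrite sup_out// => -[].
Qed.

Lemma mdist_le_lip_seminorm (f : M -> M) (K : R) (x y : M) :
  (forall x y, mdist (f x) (f y) <= K * mdist x y) ->
  mdist (f x) (f y) <= lip_seminorm f * mdist x y.
Proof.
move=> fK; have [->|xy] := eqVneq x y; first by rewrite !mdistxx mulr0.
rewrite -ler_pdivrMr ?mdist_gt0//; apply: ub_le_sup; last by exists x, y.
by exists K => _ [u [v [uv ->]]]; rewrite ler_pdivrMr ?mdist_gt0.
Qed.

Lemma lip_const_fun f x y : mdist (f x) (f y) <= lip_const f * mdist x y.
Proof.
have [K fK] := lip_fun_lipschitz f.
rewrite (le_trans (mdist_le_lip_seminorm _ _ fK))// ler_wpM2r ?mdist_ge0//.
by rewrite le_max lexx.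
Qed.

Lemma lip_const_inv f x y : mdist x y <= lip_const f * mdist (f x) (f y).
Proof.
have [K fK] := lip_inv_lipschitz f.
have := mdist_le_lip_seminorm (f x) (f y) fK; rewrite !lip_funK => /le_trans; apply.
by rewrite ler_wpM2r ?mdist_ge0// le_max lexx orbT.
Qed.

Lemma lip_const_ge0 f : 0 <= lip_const f.
Proof. by rewrite le_max lip_seminorm_ge0. Qed.

(** With L the constant, d(x, y) <= L d(f x, f y) <= L^2 d(x, y). *)
Lemma lip_const_ge1 f (x y : M) : x != y -> 1 <= lip_const f.
Proof.
rewrite -mdist_gt0 => xy; rewrite -(@ler_pXn2r _ 2) ?nnegrE ?lip_const_ge0//.
rewrite expr1n -(ler_pM2r xy) mul1r expr2 -mulrA.
apply: (le_trans (lip_const_inv f x y)).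
by rewrite ler_wpM2l ?lip_const_ge0// lip_const_fun.
Qed.

(* If M is a point, [lip_const f] is a supremum over the empty set, hence 0. *)
Lemma ln_max_lip_const f : ln (Num.max 1 (lip_const f)) = ln (lip_const f).
Proof.
have [[x [y xy]]|all_eq] := pselect (exists x y : M, x != y).
  by rewrite max_r// (lip_const_ge1 f xy).
suff L0 : lip_const f = 0 by rewrite L0 max_l// ln1 ln0.
have sn0 (h : M -> M) : lip_seminorm h = 0.
  rewrite /lip_seminorm (_ : [set _ | _] = set0) ?sup0//.
  by rewrite -subset0 => r [x [y [xy _]]]; apply: all_eq; exists x, y.
by rewrite /lip_const !sn0 maxxx.
Qed.

Lemma max_lip_const_fun f x y :
  mdist (f x) (f y) <= Num.max 1 (lip_const f) * mdist x y.
Proof.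
by rewrite (le_trans (lip_const_fun f x y))// ler_wpM2r ?mdist_ge0// le_max lexx orbT.
Qed.

Lemma max_lip_const_inv f x y :
  mdist x y <= Num.max 1 (lip_const f) * mdist (f x) (f y).
Proof.
by rewrite (le_trans (lip_const_inv f x y))// ler_wpM2r ?mdist_ge0// le_max lexx orbT.
Qed.

End lip_const.

(** * Distortion and localization of kernels close to the power of the logarithm *)

Section kernel_family.
Context {R : realType} {M : pmetricType R}.
Hypothesis M_compact : compact [set: M].

Lemma uniformly_continuous (phi : M -> R) (e : R) : continuous phi -> 0 < e ->
  exists2 s : R, 0 < s & forall x y, mdist x y < s -> `|phi x - phi y| < e.
Proof.
move=> phi_cont e0; have e2 : 0 < e / 2 by rewrite divr_gt0.
have := (compact_near_coveringP _).1 M_compact R (0^'+)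
  (fun s x => forall y, mdist x y < s -> `|phi x - phi y| < e) _.
case=> [x _|s0 /= s0_gt0 H].
  have : \forall z \near x, `|phi x - phi z| < e / 2.
    by move/cvgrPdist_lt : (phi_cont x) => /(_ _ e2).
  move=> /nbhs_ballP[r /= r0 xr]; have r2 : 0 < r / 2 by rewrite divr_gt0.
  exists (ball x (r / 2), [set s | s < r / 2]).
    by split; [exact: nbhsx_ballx|exact: nbhs_right_lt].
  move=> [x' s] [/=]; rewrite ballEmdist/= => xx' sr y x'y.
  rewrite (_ : phi x' - phi y = (phi x - phi y) - (phi x - phi x')); last by ring.
  rewrite (le_lt_trans (ler_normB _ _))// [ltRHS](splitr e) ltrD//.
    apply: xr; rewrite ballEmdist/= (le_lt_trans (metric_triangle x x' y))//.
    by rewrite (splitr r) ltrD// (lt_trans x'y).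
  by apply: xr; rewrite ballEmdist/= (lt_le_trans xx')// ler_pdivrMr// ler_peMr ?(ltW r0)// ler1n.
exists (s0 / 2); first by rewrite divr_gt0.
move=> x y; apply: (H (s0 / 2)) => //=.
  by rewrite sub0r normrN gtr0_norm ?divr_gt0// ltr_pdivrMr// ltr_pMr// ltr1n.
by rewrite divr_gt0.
Qed.

Variables (alpha : R) (fs : nat -> seq (M -> R)).
Hypothesis alpha_gt0 : 0 < alpha.
Hypothesis fs_nice : forall T phi, phi \in fs T ->
  continuous phi /\ forall x, 0 <= phi x.
Hypothesis fs_upper : forall d : R, 0 < d -> exists C : R, 0 <= C /\
  forall T x y, feature_kernel (fs T) x y <= (1 + d) * log_cutoff T x y `^ alpha + C.
Hypothesis fs_lower : forall d : R, 0 < d -> exists C : R, 0 <= C /\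
  forall T x y, log_cutoff T x y `^ alpha <= (1 + d) * feature_kernel (fs T) x y + C.

Lemma kernel_ge0 T x y : 0 <= feature_kernel (fs T) x y.
Proof.
rewrite /feature_kernel big_seq; apply: sumr_ge0 => phi /fs_nice[_ p0].
by rewrite mulr_ge0.
Qed.

(** The kernel at (x', y') is compared with the truncated logarithm there, this with the one at (x,
    y) shifted by ln L, and the latter with the kernel at (x, y). *)
Lemma kernel_distortion (d : R) : 0 < d -> exists C : R, 0 <= C /\
  forall T x y x' y' L, 1 <= L -> mdist x y <= L * mdist x' y' ->
  feature_kernel (fs T) x' y' <= (1 + d) * feature_kernel (fs T) x y + C * (1 + ln L `^ alpha).
Proof.
(* Each of the three comparisons costs a factor 1 + e, and (1 + e)^3 <= 1 + 7 e for e <= 1. *)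
move=> d0; pose e := Num.min 1 (d / 7).
have e0 : 0 < e by rewrite lt_min ltr01 divr_gt0.
have e1 : e <= 1 by rewrite ge_min lexx.
have ed : e <= d / 7 by rewrite ge_min lexx orbT.
have [C1 [C10 H1]] := fs_upper e0; have [C2 [C20 H2]] := powR_add_le alpha_gt0 e0.
have [C3 [C30 H3]] := fs_lower e0.
exists (C1 + 4 * C3 + 2 * C2); split=> [|T x y x' y' L L1 xy]; first by lra.
have lnL : 0 <= ln L `^ alpha by exact: powR_ge0.
have k0 := kernel_ge0 T x y.
have l_le : log_cutoff T x' y' `^ alpha <= (log_cutoff T x y + ln L) `^ alpha.
  rewrite ge0_ler_powR ?nnegrE ?addr_ge0 ?log_cutoff_ge0 ?ln_ge0 ?(ltW alpha_gt0)//.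
  exact: log_cutoff_shift xy.
have h1 := H1 T x' y'; have h3 := H3 T x y.
have h2 := H2 _ _ (log_cutoff_ge0 T x y) (ln_ge0 L1).
move: l_le h1 h2 h3; set a := log_cutoff _ _ _ `^ _; set b := _ `^ alpha.
set c := log_cutoff _ _ _ `^ _; set l := _ `^ alpha in lnL *.
set k := feature_kernel _ _ _ in k0 *; set k' := feature_kernel _ _ _ => ab h1 h2 h3.
have s1 : k' <= (1 + e) * ((1 + e) * c + C2 * l) + C1.
  by rewrite (le_trans h1)// lerD2r ler_wpM2l ?(le_trans ab h2)// addr_ge0// ltW.
have s2 : (1 + e) * c <= (1 + e) * ((1 + e) * k + C3).
  by rewrite ler_wpM2l// addr_ge0// ltW.
have s3 : k' <= (1 + e) * ((1 + e) * ((1 + e) * k + C3) + C2 * l) + C1.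
  by rewrite (le_trans s1)// lerD2r ler_wpM2l ?addr_ge0 ?(ltW e0)// lerD2r.
apply: (le_trans s3).
have e3 : (1 + e) * ((1 + e) * (1 + e)) <= 1 + d.
  have : e * e <= e by rewrite ler_piMr// ltW.
  have : e * (e * e) <= e * e by rewrite ler_piMl ?mulr_ge0 ?(ltW e0).
  by nra.
have t1 : (1 + e) * ((1 + e) * (1 + e)) * k <= (1 + d) * k by rewrite ler_wpM2r.
have t2 : (1 + e) * (1 + e) * C3 <= 4 * C3 by rewrite ler_wpM2r//; nra.
have t3 : (1 + e) * (C2 * l) <= 2 * (C2 * l) by rewrite ler_wpM2r ?mulr_ge0//; lra.
have t4 : 0 <= C1 * l by rewrite mulr_ge0.
have t5 : 0 <= C3 * l by rewrite mulr_ge0.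
by lra.
Qed.

(** Nearby points have almost equal values of phi, by uniform continuity; at distance at least s the
    kernel is bounded independently of T. *)
Lemma kernel_localization (phi : M -> R) (d : R) : continuous phi ->
  (forall x, 0 <= phi x <= 1) -> 0 < d -> exists C : R, 0 <= C /\ forall T x y,
  phi x * feature_kernel (fs T) x y <=
    phi y * feature_kernel (fs T) x y + d * feature_kernel (fs T) x y + C.
Proof.
move=> phi_cont phi01 d0; have [s s0 Hs] := uniformly_continuous phi_cont d0.
have [C [C0 HC]] := fs_upper ltr01.
pose B := Num.max 0 (- ln s).
exists ((1 + 1) * B `^ alpha + C); split=> [|T x y].
  by rewrite addr_ge0// mulr_ge0// powR_ge0.
have k0 := kernel_ge0 T x y; have /andP[px0 px1] := phi01 x.
have /andP[py0 py1] := phi01 y.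
have [xy|sxy] := ltP (mdist x y) s.
  apply: (@le_trans _ _ ((phi y + d) * feature_kernel (fs T) x y)).
    rewrite ler_wpM2r//; have := Hs x y xy; rewrite ltr_norml => /andP[]; lra.
  by rewrite mulrDl lerDl addr_ge0// mulr_ge0// powR_ge0.
apply: (@le_trans _ _ (feature_kernel (fs T) x y)); first by rewrite ler_piMl.
apply: (le_trans (HC T x y)); rewrite (@le_trans _ _ ((1 + 1) * B `^ alpha + C))//.
  rewrite lerD2r ler_wpM2l// ge0_ler_powR ?nnegrE ?log_cutoff_ge0 ?(ltW alpha_gt0)//.
    by rewrite le_max lexx.
  rewrite ge_max; apply/andP; split; first by rewrite le_max lexx.
  rewrite le_max; apply/orP; right; rewrite lerN2 ler_ln ?posrE//.
    by rewrite le_max sxy.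
  by rewrite lt_max expR_gt0 orbT.
by rewrite lerDr addr_ge0// mulr_ge0// ltW.
Qed.

(** At distance at most 2 r the truncated logarithm is at least |ln r| - ln 2, provided that the
    truncation T is at least |ln r|. *)
Lemma log_ball_lower : exists C : R, 0 <= C /\ forall T x y (r : R),
  0 < r < 1 -> `|ln r| <= T%:R -> mdist x y <= 2 * r ->
  `|ln r| `^ alpha <= C * feature_kernel (fs T) x y + C.
Proof.
have [C1 [C10 H1]] := powR_add_le alpha_gt0 ltr01.
have [C2 [C20 H2]] := fs_lower ltr01.
have ln2 : 0 <= ln 2 :> R by apply: ln_ge0; rewrite ler1n.
exists (4 + 2 * C2 + C1 * ln 2 `^ alpha); split.
  by rewrite addr_ge0 ?mulr_ge0 ?powR_ge0// addr_ge0 ?mulr_ge0.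
move=> T x y r /andP[r0 r1] rT xy.
have rE : `|ln r| = - ln r by rewrite ler0_norm// ln_le0// ltW.
have l_le : `|ln r| <= log_cutoff T x y + ln 2.
  rewrite -lerBlDr; apply: le_log_cutoff; last by rewrite lerBlDr (le_trans rT)// lerDl.
  by rewrite rE opprB opprK expRD !lnK ?posrE.
apply: (@le_trans _ _ ((log_cutoff T x y + ln 2) `^ alpha)).
  by rewrite ge0_ler_powR ?nnegrE ?addr_ge0 ?log_cutoff_ge0 ?(ltW alpha_gt0).
have := H1 _ _ (log_cutoff_ge0 T x y) ln2; have := H2 T x y.
have k0 := kernel_ge0 T x y; have p0 : 0 <= ln 2 `^ alpha :> R by exact: powR_ge0.
have := mulr_ge0 C20 k0; have := mulr_ge0 (mulr_ge0 C10 p0) k0; lra.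
Qed.

End kernel_family.

(** * Comparison of bilinear forms in the means *)

Section form_comparison.
Context d (T : measurableType d) (R : realType) (P : probability T R).
Context (I : eqType) (l : seq I).

Let bounded_pair (u v : I -> T -> R) : Prop :=
  forall i, i \in l -> bounded_mfun (u i) /\ bounded_mfun (v i).

(** The right-hand side is again a kernel of finite rank, the constant C being the product of the
    functions C and 1; [rank_form_le] applies. *)
Lemma bilinear_mean_le (u v u1 v1 u2 v2 : I -> T -> R) (e C : R) :
  bounded_pair u v -> bounded_pair u1 v1 -> bounded_pair u2 v2 ->
  (forall x y, \sum_(i <- l) u i x * v i y <= \sum_(i <- l) u1 i x * v1 i y +
    e * (\sum_(i <- l) u2 i x * v2 i y) + C) ->
  \sum_(i <- l) mean P (u i) * mean P (v i) <=
    \sum_(i <- l) mean P (u1 i) * mean P (v1 i) +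
    e * (\sum_(i <- l) mean P (u2 i) * mean P (v2 i)) + C.
Proof.
move=> b b1 b2 le.
pose l0 := [seq (u i, v i) | i <- l].
pose l1 := [seq (u1 i, v1 i) | i <- l] ++
  [seq ((fun x => e * u2 i x), v2 i) | i <- l] ++ [:: ((fun=> C), (fun=> 1))].
have bl0 : bounded_rank l0 by move=> p /mapP[i il ->]; exact: b.
have bl1 : bounded_rank l1.
  move=> p; rewrite !mem_cat => /orP[/mapP[i il ->]|/orP[/mapP[i il ->]|]].
  - exact: b1.
  - by have [h1 h2] := b2 i il; split => //; exact: bounded_mfunZ.
  - by rewrite inE => /eqP ->; split; exact: bounded_mfun_cst.
have := rank_form_le P bl0 bl1; rewrite /rank_kernel /rank_form.
rewrite !big_cat/= !big_map !big_seq1/= !mean_cst mulr1 addrA mulr_sumr.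
have -> : \sum_(i <- l) mean P (fun x => e * u2 i x) * mean P (v2 i) =
    \sum_(i <- l) e * (mean P (u2 i) * mean P (v2 i)).
  rewrite big_seq [RHS]big_seq; apply: eq_bigr => i il.
  by have [h1 _] := b2 i il; rewrite meanZ// mulrA.
apply=> x y; rewrite !big_cat/= !big_map big_seq1/= mulr1 addrA.
apply: (le_trans (le x y)); rewrite mulr_sumr !lerD2r lerD2l.
by apply: ler_sum => i _; rewrite mulrA.
Qed.

(** Young's inequality term by term. A small t will multiply an energy, and 1 / t a discrepancy. *)
Lemma sum_mul_le_sqr (t : R) (a b : I -> R) : 0 < t ->
  `|\sum_(i <- l) a i * b i| <=
    t * \sum_(i <- l) a i ^+ 2 + t^-1 * \sum_(i <- l) b i ^+ 2.
Proof.
move=> t0; rewrite (le_trans (ler_norm_sum _ _ _))// !mulr_sumr -big_split/=.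
apply: ler_sum => i _; set x := a i; set y := b i.
have -> : t * x ^+ 2 + t^-1 * y ^+ 2 = (t * x ^+ 2 + t^-1 * y ^+ 2 - `|x * y|) + `|x * y|.
  by ring.
rewrite lerDr subr_ge0 normrM -(real_normK (num_real x)) -(real_normK (num_real y)).
move: `|x| `|y| (normr_ge0 x) (normr_ge0 y) => p q p0 q0.
have := sqr_ge0 (t * p - q); rewrite sqrrB => h.
have h2 : t * p * q <= t * (t * p ^+ 2) + q ^+ 2.
  have : 0 <= t * p * q by rewrite !mulr_ge0// ltW.
  by move: h; rewrite exprMn mulr2n; lra.
rewrite -(ler_pM2l t0) mulrDr mulrA mulrA (mulrA t t^-1) divff ?gt_eqF// mul1r.
by rewrite -(mulrA t t).
Qed.

End form_comparison.

(** * Energy, discrepancy and localized energy *)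

Section energy.
Context {R : realType} {M : pmetricType R}.
Hypothesis M_compact : compact [set: M].
Implicit Types (nu : probability (borelType M) R) (l : seq (M -> R)).

Definition energy nu l : R := \sum_(phi <- l) mean nu phi ^+ 2.

Definition orbit_energy nu l (f : lipHomeo M) : R :=
  \sum_(phi <- l) orbit_mean nu phi f ^+ 2.

(** The squared norm of f_* nu - nu, for the norm given by the kernel. *)
Definition discrepancy nu l (f : lipHomeo M) : R :=
  \sum_(phi <- l) (orbit_mean nu phi f - mean nu phi) ^+ 2.

(* The double integral of [psi x * feature_kernel l x y]. *)
Definition localized_energy nu l (psi : M -> R) : R :=
  \sum_(phi <- l) mean nu (fun x => psi x * phi x) * mean nu phi.

Lemma energy_ge0 nu l : 0 <= energy nu l.
Proof. by apply: sumr_ge0 => phi _; exact: sqr_ge0. Qed.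

Lemma discrepancy_ge0 nu l f : 0 <= discrepancy nu l f.
Proof. by apply: sumr_ge0 => phi _; exact: sqr_ge0. Qed.

Lemma continuous_comp_lip (phi : M -> R) (f : lipHomeo M) : continuous phi ->
  continuous (phi \o f).
Proof.
by move=> pc x; apply: continuous_comp; [exact: lipHomeo_continuous|exact: pc].
Qed.

Lemma continuous_mul (phi psi : M -> R) : continuous phi -> continuous psi ->
  continuous (fun x => phi x * psi x).
Proof. by move=> pc qc x; apply: cvgM; [exact: pc|exact: qc]. Qed.

Variables (alpha : R) (fs : nat -> seq (M -> R)).
Hypothesis alpha_gt0 : 0 < alpha.
Hypothesis fs_nice : forall T phi, phi \in fs T ->
  continuous phi /\ forall x, 0 <= phi x.
Hypothesis fs_upper : forall d : R, 0 < d -> exists C : R, 0 <= C /\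
  forall T x y, feature_kernel (fs T) x y <= (1 + d) * log_cutoff T x y `^ alpha + C.
Hypothesis fs_lower : forall d : R, 0 < d -> exists C : R, 0 <= C /\
  forall T x y, log_cutoff T x y `^ alpha <= (1 + d) * feature_kernel (fs T) x y + C.

Let kernel_nonneg := kernel_ge0 fs_nice.

Let distortion := kernel_distortion alpha_gt0 fs_nice fs_upper fs_lower.

Let bounded_cont (phi : M -> R) : continuous phi ->
  bounded_mfun (phi : borelType M -> R).
Proof. exact: continuous_bounded_mfun. Qed.

Lemma orbit_energy_le (d : R) : 0 < d -> exists C : R, 0 <= C /\
  forall T nu f, orbit_energy nu (fs T) f <=
    (1 + d) * energy nu (fs T) + C * (1 + ln (lip_const f) `^ alpha).
Proof.
move=> d0; have [C [C0 HC]] := distortion d0; exists C; split=> // T nu f.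
rewrite /orbit_energy /energy; under eq_bigr do rewrite expr2.
under [in leRHS]eq_bigr do rewrite expr2.
rewrite mulrDl mul1r.
apply: (@bilinear_mean_le _ (borelType M) _ nu _ (fs T) (fun phi => phi \o f)
  (fun phi => phi \o f) id id id id).
- move=> phi /fs_nice[pc _].
  by split; apply: bounded_cont => //; exact: continuous_comp_lip.
- by move=> phi /fs_nice[pc _]; split; exact: bounded_cont.
- by move=> phi /fs_nice[pc _]; split; exact: bounded_cont.
- move=> x y; rewrite -ln_max_lip_const.
  have L1 : 1 <= Num.max 1 (lip_const f) by rewrite le_max lexx.
  by have := HC T x y (f x) (f y) _ L1 (max_lip_const_inv f x y); rewrite mulrDl mul1r.
Qed.

(** [transported] is the localized energy of psi for f_* nu. It integrates psi(f x) k(f x, f y)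
    where the other side has psi(f x) k(x, y), so distortion applies in both directions; as psi <=
    1, the error is d times the energy of the measure on the dominating side, plus a constant. *)
Lemma energy_transport_error (f : lipHomeo M) (psi : M -> R) (d : R) :
  continuous psi -> (forall x, 0 <= psi x <= 1) -> 0 < d ->
  exists C : R, 0 <= C /\ forall T nu,
  let transported := \sum_(phi <- fs T)
    orbit_mean nu (fun x => psi x * phi x) f * orbit_mean nu phi f in
  transported <= localized_energy nu (fs T) (psi \o f) + d * energy nu (fs T) + C /\
  localized_energy nu (fs T) (psi \o f) <= transported + d * orbit_energy nu (fs T) f + C.
Proof.
move=> psi_cont psi01 d0; have [C [C0 HC]] := distortion d0.
set K := C * (1 + ln (Num.max 1 (lip_const f)) `^ alpha).
have K0 : 0 <= K by rewrite mulr_ge0// addr_ge0// powR_ge0.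
have L1 : 1 <= Num.max 1 (lip_const f) by rewrite le_max lexx.
have pf_cont := continuous_comp_lip (f := f) psi_cont.
exists K; split=> // T nu /=; rewrite /energy /orbit_energy.
have mul_le (p k k' : R) : 0 <= p <= 1 -> 0 <= k' -> k <= (1 + d) * k' + K ->
    p * k <= p * k' + d * k' + K.
  move=> /andP[p0 p1] k'0 kk'.
  have : p * k <= p * ((1 + d) * k' + K) by rewrite ler_wpM2l.
  have : p * (d * k' + K) <= d * k' + K.
    by rewrite ler_piMl// addr_ge0// mulr_ge0// ltW.
  by lra.
have pull (q : M -> R) x y :
    \sum_(phi <- fs T) q x * phi x * phi y = q x * feature_kernel (fs T) x y.
  by rewrite /feature_kernel mulr_sumr; apply: eq_bigr => phi _; rewrite mulrA.
split.
- under [in X in _ + d * X]eq_bigr do rewrite expr2.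
  apply: (@bilinear_mean_le _ (borelType M) _ nu _ (fs T)
    (fun phi => (fun x => psi x * phi x) \o f) (fun phi => phi \o f)
    (fun phi x => psi (f x) * phi x) id id id).
  + move=> phi /fs_nice[pc _]; split; apply: bounded_cont => //.
      by apply: continuous_comp_lip; exact: continuous_mul.
    exact: continuous_comp_lip.
  + move=> phi /fs_nice[pc _]; split; apply: bounded_cont => //.
    exact: (continuous_mul pf_cont).
  + by move=> phi /fs_nice[pc _]; split; exact: bounded_cont.
  move=> x y /=; rewrite (pull psi (f x) (f y)).
  rewrite (pull (psi \o f) x y); apply: mul_le;
    [exact: psi01|exact: kernel_nonneg|].
  by apply: HC => //; exact: max_lip_const_inv.
- under [in X in _ + d * X]eq_bigr do rewrite expr2.
  apply: (@bilinear_mean_le _ (borelType M) _ nu _ (fs T)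
    (fun phi x => psi (f x) * phi x) id
    (fun phi => (fun x => psi x * phi x) \o f) (fun phi => phi \o f)
    (fun phi => phi \o f) (fun phi => phi \o f)).
  + move=> phi /fs_nice[pc _]; split; apply: bounded_cont => //.
    exact: (continuous_mul pf_cont).
  + move=> phi /fs_nice[pc _]; split; apply: bounded_cont => //.
      by apply: continuous_comp_lip; exact: continuous_mul.
    exact: continuous_comp_lip.
  + move=> phi /fs_nice[pc _].
    by split; apply: bounded_cont => //; exact: continuous_comp_lip.
  move=> x y /=; rewrite (pull psi (f x) (f y)).
  rewrite (pull (psi \o f) x y); apply: mul_le;
    [exact: psi01|exact: kernel_nonneg|].
  by apply: HC => //; exact: max_lip_const_fun.
Qed.

(* [psi] may be moved from one variable of the kernel to the other, since the
   kernel is bounded away from the diagonal. *)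
Lemma localization_symmetry (psi : M -> R) (d : R) :
  continuous psi -> (forall x, 0 <= psi x <= 1) -> 0 < d ->
  exists C : R, 0 <= C /\ forall T nu (f : lipHomeo M),
  `|\sum_(phi <- fs T) orbit_mean nu (fun x => psi x * phi x) f * mean nu phi -
    \sum_(phi <- fs T) orbit_mean nu phi f * mean nu (fun x => psi x * phi x)| <=
  d * (\sum_(phi <- fs T) orbit_mean nu phi f * mean nu phi) + C.
Proof.
move=> psi_cont psi01 d0.
have [C [C0 HC]] := kernel_localization M_compact alpha_gt0 fs_nice fs_upper psi_cont psi01 d0.
exists C; split=> // T nu f.
have pull1 x y : \sum_(phi <- fs T) psi x * phi x * phi y = psi x * feature_kernel (fs T) x y.
  by rewrite /feature_kernel mulr_sumr; apply: eq_bigr => phi _; rewrite mulrA.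
have pull2 x y : \sum_(phi <- fs T) phi x * (psi y * phi y) = psi y * feature_kernel (fs T) x y.
  by rewrite /feature_kernel mulr_sumr; apply: eq_bigr => phi _; rewrite mulrCA.
have kernelC x y : feature_kernel (fs T) x y = feature_kernel (fs T) y x.
  by apply: eq_bigr => phi _; rewrite mulrC.
have b1 phi : phi \in fs T -> bounded_mfun ((fun x => psi x * phi x) \o f : borelType M -> R)
    /\ bounded_mfun (phi : borelType M -> R).
  move=> /fs_nice[pc _]; split; apply: bounded_cont => //.
  by apply: continuous_comp_lip; exact: continuous_mul.
have b2 phi : phi \in fs T -> bounded_mfun (phi \o f : borelType M -> R)
    /\ bounded_mfun ((fun x => psi x * phi x) : borelType M -> R).
  move=> /fs_nice[pc _]; split; apply: bounded_cont => //.
    exact: continuous_comp_lip.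
  exact: continuous_mul.
have b3 phi : phi \in fs T -> bounded_mfun (phi \o f : borelType M -> R)
    /\ bounded_mfun (phi : borelType M -> R).
  move=> /fs_nice[pc _]; split; apply: bounded_cont => //.
  exact: continuous_comp_lip.
rewrite ler_distl; apply/andP; split.
- rewrite lerBlDr addrA.
  apply: (@bilinear_mean_le _ (borelType M) _ nu _ (fs T)
    (fun phi => phi \o f) (fun phi x => psi x * phi x)
    (fun phi => (fun x => psi x * phi x) \o f) id (fun phi => phi \o f) id) => //.
  by move=> x y /=; rewrite pull1 pull2 -/(feature_kernel (fs T) (f x) y) kernelC; exact: HC.
- rewrite addrA.
  apply: (@bilinear_mean_le _ (borelType M) _ nu _ (fs T)
    (fun phi => (fun x => psi x * phi x) \o f) id
    (fun phi => phi \o f) (fun phi x => psi x * phi x) (fun phi => phi \o f) id) => //.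
  by move=> x y /=; rewrite pull1 pull2; exact: HC.
Qed.

(** Writing [a, b] for the pairing by the kernel, the chain is [(psi o f) nu, nu],
    [psi f_* nu, f_* nu], [psi f_* nu, nu], [f_* nu, psi nu], [psi nu, nu]. Its steps are
    distortion, discrepancy, symmetry, discrepancy. Symmetry moves psi onto nu before the last f_*
    nu is replaced, since the discrepancy measures f_* nu - nu and not its product with psi. *)
Lemma localized_energy_stable (f : lipHomeo M) (psi : M -> R) (e : R) :
  continuous psi -> (forall x, 0 <= psi x <= 1) -> 0 < e ->
  exists C : R, 0 <= C /\ forall T nu,
  `|localized_energy nu (fs T) (psi \o f) - localized_energy nu (fs T) psi| <=
    e * energy nu (fs T) + C * (1 + discrepancy nu (fs T) f).
Proof.
(* The errors are multiples of d E and d E', where E' <= 2 E + K3; they total at most 8 d E plus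
   terms in the constants and the discrepancy, so e / 20 is ample. *)
move=> psi_cont psi01 e0; pose d := e / 20; have d0 : 0 < d by rewrite divr_gt0.
have [C1 [C10 H1]] := energy_transport_error f psi_cont psi01 d0.
have [C2 [C20 H2]] := localization_symmetry psi_cont psi01 d0.
have [C3 [C30 H3]] := orbit_energy_le ltr01.
pose K3 := C3 * (1 + ln (lip_const f) `^ alpha).
have K30 : 0 <= K3 by rewrite mulr_ge0// addr_ge0// powR_ge0.
have dV0 : 0 <= d^-1 by rewrite invr_ge0 ltW.
exists (C1 + C2 + 4 * d * K3 + 2 * d^-1); split=> [|T nu].
  by rewrite !addr_ge0// mulr_ge0// mulr_ge0// ltW.
have := H3 T nu f; rewrite -/K3; set E := energy _ _; set E' := orbit_energy _ _ _ => hE'.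
set D := discrepancy _ _ _; have D0 : 0 <= D by exact: discrepancy_ge0.
have E0 : 0 <= E by exact: energy_ge0.
have E'0 : 0 <= E' by apply: sumr_ge0 => phi _; exact: sqr_ge0.
have [] := H1 T nu; have := H2 T nu f.
pose c phi := mean nu phi; pose c' phi := orbit_mean nu phi f.
pose b phi := mean nu (fun x => psi x * phi x).
pose b' phi := orbit_mean nu (fun x => psi x * phi x) f.
rewrite -/E -/E'; set L' := localized_energy _ _ (psi \o f).
set L := localized_energy _ _ psi.
rewrite -[X in `|X - _|]/(\sum_(phi <- fs T) b' phi * c phi).
rewrite -[X in `|_ - X|]/(\sum_(phi <- fs T) c' phi * b phi).
rewrite -[X in d * X + C2]/(\sum_(phi <- fs T) c' phi * c phi).
set S1 := \sum_(phi <- fs T) b' phi * c phi.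
set S2 := \sum_(phi <- fs T) c' phi * b phi.
set S3 := \sum_(phi <- fs T) c' phi * c phi.
rewrite -/(\sum_(phi <- fs T) b' phi * c' phi).
set S4 := \sum_(phi <- fs T) b' phi * c' phi => h2 h1a h1b.
have mulb phi : phi \in fs T -> 0 <= b phi <= c phi.
  move=> /fs_nice[pc p0]; apply/andP; split.
    by apply: mean_ge0 => x; rewrite mulr_ge0//; have /andP[] := psi01 x.
  apply: mean_le; [apply: bounded_cont => //; exact: continuous_mul|exact: bounded_cont|].
  by move=> x; rewrite ler_piMl//; have /andP[] := psi01 x.
have mulb' phi : phi \in fs T -> 0 <= b' phi <= c' phi.
  move=> /fs_nice[pc p0]; apply/andP; split.
    by apply: mean_ge0 => x /=; rewrite mulr_ge0//; have /andP[] := psi01 (f x).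
  apply: mean_le.
  - by apply: bounded_cont => //; apply: continuous_comp_lip; exact: continuous_mul.
  - by apply: bounded_cont => //; exact: continuous_comp_lip.
  - by move=> x /=; rewrite ler_piMl//; have /andP[] := psi01 (f x).
have sq_le (p q : (M -> R) -> R) : (forall phi, phi \in fs T -> 0 <= p phi <= q phi) ->
    \sum_(phi <- fs T) p phi ^+ 2 <= \sum_(phi <- fs T) q phi ^+ 2.
  move=> pq; rewrite big_seq [leRHS]big_seq; apply: ler_sum => phi /pq/andP[p0 ppq].
  by rewrite lerXn2r ?nnegrE// (le_trans p0).
have hS3 : `|S3| <= E' + E.
  have := sum_mul_le_sqr (fs T) c' c ltr01; rewrite mul1r invr1 mul1r; exact.
have h4 : `|S4 - S1| <= d * E' + d^-1 * D.
  rewrite /S4 /S1 -sumrB; under eq_bigr do rewrite -mulrBr.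
  apply: le_trans (sum_mul_le_sqr _ _ _ d0) _; rewrite lerD2r ler_wpM2l ?(ltW d0)//.
  exact: sq_le.
have h5 : `|S2 - L| <= d * E + d^-1 * D.
  have -> : S2 - L = \sum_(phi <- fs T) b phi * (c' phi - c phi).
    rewrite /S2 /L -sumrB; apply: eq_bigr => phi _.
    by rewrite -/(b phi) -/(c phi); ring.
  apply: le_trans (sum_mul_le_sqr _ _ _ d0) _; rewrite lerD2r ler_wpM2l ?(ltW d0)//.
  exact: sq_le.
move: h2 h4 h5 hS3; rewrite !ler_norml => /andP[h2a h2b] /andP[h4a h4b] /andP[h5a h5b]
  /andP[hS3a hS3b].
have dS3 : d * S3 <= d * (E' + E) by rewrite ler_wpM2l// ltW.
have dE' : d * E' <= d * ((1 + 1) * E + K3) by rewrite ler_wpM2l// ltW.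
have eE : e = 20 * d by rewrite /d; field.
have dE0 : 0 <= d * E by rewrite mulr_ge0// ltW.
have dK0 : 0 <= d * K3 by rewrite mulr_ge0// ltW.
have t1 : 0 <= C1 * D by rewrite mulr_ge0.
have t2 : 0 <= C2 * D by rewrite mulr_ge0.
have t3 : 0 <= d * K3 * D by rewrite mulr_ge0.
have t4 : 0 <= d^-1 * D by rewrite mulr_ge0.
rewrite eE; apply/andP; split; lra.
Qed.

End energy.

(** The sum of the g m has finite integral, so it is finite almost everywhere and its terms tend to
    0 there. *)
Lemma ae_cvg0 d (T : measurableType d) (R : realType) (P : probability T R)
    (g : nat -> T -> R) :
  (forall m, bounded_mfun (g m)) -> (forall m x, 0 <= g m x) ->
  (forall m, mean P (g m) <= 1 / (2 ^ m.+1)%:R) ->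
  {ae P, forall x, g ^~ x @ \oo --> 0}.
Proof.
move=> bg g0 mean_g; pose h x := (\sum_(m <oo) (g m x)%:E)%E.
have mg m : measurable_fun setT (fun x => (g m x)%:E).
  by apply/measurable_EFinP; have [] := bg m.
have h0 x : (0 <= h x)%E by apply: nneseries_ge0 => m _ _; rewrite lee_fin.
have mh : measurable_fun setT h by apply: ge0_emeasurable_sum => // m x _ _; rewrite lee_fin.
have int_h : (\int[P]_x h x < +oo)%E.
  rewrite /h integral_nneseries//; last by move=> m x _; rewrite lee_fin.
  apply: (@le_lt_trans _ _ (\sum_(m <oo) ((1 / (2 ^ m.+1)%:R)%:E : \bar R))%E).
    apply: lee_nneseries => m *; first by apply: integral_ge0 => x _; rewrite lee_fin.
    by rewrite -meanE// lee_fin.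
  have := @epsilon_trick R (fun=> 0%E) 1 xpredT (fun=> lexx _) ler01.
  rewrite [X in (_ <= X + _)%E]eseries0// add0e => le1.
  apply: le_lt_trans (ltry 1); apply: le_trans le1.
  by apply: lee_nneseries => m *; rewrite ?add0e lee_fin ?divr_ge0.
have ih : P.-integrable setT h.
  apply/integrableP; split=> //.
  by under eq_integral do rewrite gee0_abs//.
apply: filterS (integrable_ae measurableT ih) => x /(_ Logic.I) hx.
have : (h x < +oo)%E by rewrite -ge0_fin_numE.
move=> /nneseries_tail_cvg/(_ (fun m _ => g0 m x)) tail.
suff sq : (fun m => (g m x)%:E) @ \oo --> (0 : R)%:E by exact: (fine_cvg sq).
apply: (squeeze_cvge _ (cvg_cst 0%E) tail); apply: nearW => m; rewrite lee_fin g0/=.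
have := @nneseries_lim_ge R (fun k => (g k x)%:E) xpredT m m.+1 (fun k _ _ => g0 k x).
by rewrite big_nat1.
Qed.

(** * Averages over f *)

Section moments.
Context {R : realType} {M : pmetricType R}.
Hypothesis M_compact : compact [set: M].
Variables (alpha : R) (fs : nat -> seq (M -> R)).
Hypothesis alpha_gt0 : 0 < alpha.
Hypothesis fs_nice : forall T phi, phi \in fs T ->
  continuous phi /\ forall x, 0 <= phi x.
Hypothesis fs_upper : forall d : R, 0 < d -> exists C : R, 0 <= C /\
  forall T x y, feature_kernel (fs T) x y <= (1 + d) * log_cutoff T x y `^ alpha + C.
Hypothesis fs_lower : forall d : R, 0 < d -> exists C : R, 0 <= C /\
  forall T x y, log_cutoff T x y `^ alpha <= (1 + d) * feature_kernel (fs T) x y + C.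
Variable mu : probability (borelType (lipHomeo M)) R.
Hypothesis mu_moment :
  (\int[mu]_f ((ln (lip_const (f : lipHomeo M))) `^ alpha)%:E < +oo)%E.
Implicit Types nu : probability (borelType M) R.

Let orbit_bounded nu T phi : phi \in fs T ->
  bounded_mfun (orbit_mean nu phi : borelType (lipHomeo M) -> R).
Proof. by move=> /fs_nice[pc p0]; exact: bounded_mfun_orbit_mean. Qed.

Lemma bounded_mfun_orbit_energy nu T :
  bounded_mfun (orbit_energy nu (fs T) : borelType (lipHomeo M) -> R).
Proof.
apply: bounded_mfun_sum => phi /orbit_bounded b; exact: bounded_mfunX.
Qed.

Lemma bounded_mfun_discrepancy nu T :
  bounded_mfun (discrepancy nu (fs T) : borelType (lipHomeo M) -> R).
Proof.
apply: bounded_mfun_sum => phi /orbit_bounded b; apply: bounded_mfunX.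
by apply: bounded_mfunB => //; exact: bounded_mfun_cst.
Qed.

(* [lip_const] is not known to be measurable: [le_integral_nonneg] is applied
   with a measurable minorant of its power. *)
Lemma mean_orbit_energy_le (d : R) : 0 < d -> exists C : R, 0 <= C /\
  forall T nu, mean mu (orbit_energy nu (fs T)) <= (1 + d) * energy nu (fs T) + C.
Proof.
move=> d0.
have [C [C0 HC]] := orbit_energy_le M_compact alpha_gt0 fs_nice fs_upper fs_lower d0.
pose moment := (\int[mu]_f ((ln (lip_const (f : lipHomeo M))) `^ alpha)%:E)%E.
have moment_fin : moment \is a fin_num.
  by rewrite ge0_fin_numE// integral_ge0// => f _; rewrite lee_fin powR_ge0.
pose C' := C + 1; have C'0 : 0 < C' by rewrite ltr_wpDl.
exists (C + C' * fine moment); split=> [|T nu].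
  by rewrite addr_ge0// mulr_ge0 ?(ltW C'0)// fine_ge0// integral_ge0// => f _;
    rewrite lee_fin powR_ge0.
set E := energy nu (fs T); set h := orbit_energy nu (fs T).
pose a := (1 + d) * E + C.
(* The measurable minorant: [orbit_energy_le] gives h - a <= C (ln L)^alpha, so the positive part of
   (h - a) / C' is at most (ln L)^alpha. Taking C' = C + 1 avoids a division by 0. *)
pose k (f : lipHomeo M) := Num.max (C'^-1 * (h f - a)) 0.
have bh := bounded_mfun_orbit_energy nu T; rewrite -/h in bh.
have bha : bounded_mfun (fun f : borelType (lipHomeo M) => C'^-1 * (h f - a)).
  by apply: bounded_mfunZ; apply: bounded_mfunB => //; exact: bounded_mfun_cst.
have bk : bounded_mfun (k : borelType (lipHomeo M) -> R).
  have [m [B hB]] := bha; split; first by apply: measurable_maxr => //; exact: measurable_cst.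
  exists B => f; have B0 : 0 <= B by exact: le_trans (hB f).
  rewrite ger0_norm ?le_max ?lexx ?orbT// ge_max B0 andbT.
  exact: le_trans (ler_norm _) (hB f).
have k_moment : mean mu k <= fine moment.
  rewrite -lee_fin meanE// fineK//; apply: le_integral_nonneg => f _.
    by rewrite lee_fin le_max lexx orbT.
  rewrite lee_fin ge_max powR_ge0 andbT mulrC ler_pdivrMr//.
  have := HC T nu f; rewrite -/h -/E /a /C'.
  have : 0 <= ln (lip_const f) `^ alpha by exact: powR_ge0.
  by lra.
apply: (@le_trans _ _ (mean mu (fun f => a + C' * k f))).
  apply: mean_le => //.
    by apply: bounded_mfunD; [exact: bounded_mfun_cst|exact: bounded_mfunZ].
  move=> f; rewrite -lerBlDl -ler_pdivrMl// le_max lexx//.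
rewrite meanD; [|exact: bounded_mfun_cst|exact: bounded_mfunZ].
rewrite mean_cst meanZ// /a addrA lerD2l ler_wpM2l// ltW//.
Qed.

(** A variance formula for each feature: by stationarity, [mean nu phi] is the average of
    [orbit_mean nu phi] over f. *)
Lemma mean_discrepancy nu T : stationary mu nu ->
  mean mu (discrepancy nu (fs T)) =
  mean mu (orbit_energy nu (fs T)) - energy nu (fs T).
Proof.
move=> st; rewrite /discrepancy /orbit_energy /energy.
rewrite mean_sum; last first.
  move=> phi /orbit_bounded b; apply: bounded_mfunX.
  by apply: bounded_mfunB => //; exact: bounded_mfun_cst.
rewrite mean_sum; last by move=> phi /orbit_bounded b; exact: bounded_mfunX.
rewrite -sumrB big_seq [RHS]big_seq; apply: eq_bigr => phi phi_fs.
have [pc p0] := fs_nice phi_fs; have b := orbit_bounded nu phi_fs.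
have b2 := bounded_mfunX 2 b.
have -> : (fun f => (orbit_mean nu phi f - mean nu phi) ^+ 2) =
    (fun f => orbit_mean nu phi f ^+ 2 +
      (- (2 * mean nu phi) * orbit_mean nu phi f + mean nu phi ^+ 2)).
  by apply/funext => f; ring.
rewrite meanD//; last first.
  by apply: bounded_mfunD; [exact: bounded_mfunZ|exact: bounded_mfun_cst].
rewrite meanD; [|exact: bounded_mfunZ|exact: bounded_mfun_cst].
by rewrite meanZ// mean_cst stationary_mean//; ring.
Qed.

Lemma mean_discrepancy_le (d : R) : 0 < d -> exists C : R, 0 <= C /\
  forall T nu, stationary mu nu ->
  mean mu (discrepancy nu (fs T)) <= d * energy nu (fs T) + C.
Proof.
move=> d0; have [C [C0 HC]] := mean_orbit_energy_le d0.
by exists C; split=> // T nu st; rewrite mean_discrepancy//; have := HC T nu; lra.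
Qed.

Lemma unbounded_energy_sequence :
  (forall C : R, exists T nu, stationary mu nu /\ C < energy nu (fs T)) ->
  exists (T : nat -> nat) (nu : nat -> probability (borelType M) R),
    (forall m, m.+1%:R < energy (nu m) (fs (T m))) /\
    {ae mu, forall f : lipHomeo M, (fun m => (energy (nu m) (fs (T m)))^-1 *
      discrepancy (nu m) (fs (T m)) f) @ \oo --> 0}.
Proof.
move=> unbounded.
have /choice[p Hp] : forall m : nat, exists p : nat * probability (borelType M) R,
    m.+1%:R < energy p.2 (fs p.1) /\
    mean mu (fun f => (energy p.2 (fs p.1))^-1 * discrepancy p.2 (fs p.1) f) <=
      1 / (2 ^ m.+1)%:R.
  move=> m; pose e : R := 1 / (2 ^ m.+1)%:R.
  have e0 : 0 < e by rewrite divr_gt0// ltr0n expn_gt0.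
  have e2 : 0 < e / 2 by rewrite divr_gt0.
  have [C [C0 HC]] := mean_discrepancy_le e2.
  (* Beyond this threshold C <= (e / 2) times the energy, so the mean discrepancy is at most e times
     the energy, with e = 2^-(m + 1) summable in m. *)
  have [T [nu [st big]]] := unbounded (m.+1%:R + C / (e / 2)).
  have Ce : 0 <= C / (e / 2) by rewrite divr_ge0// ltW.
  exists (T, nu) => /=; have E0 : 0 < energy nu (fs T).
    by apply: lt_trans big; rewrite ltr_wpDr.
  split; first by rewrite (le_lt_trans _ big)// lerDl.
  rewrite meanZ; last exact: bounded_mfun_discrepancy.
  rewrite ler_pdivrMl//; apply: (le_trans (HC T nu st)).
  have : C <= (e / 2) * energy nu (fs T).
    rewrite mulrC -ler_pdivrMr// ltW// (le_lt_trans _ big)// lerDr//.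
  by rewrite -/e; lra.
exists (fun m => (p m).1), (fun m => (p m).2); split.
  by move=> m; have [] := Hp m.
apply: (@ae_cvg0 _ (borelType (lipHomeo M)) R mu (fun m f =>
  (energy (p m).2 (fs (p m).1))^-1 * discrepancy (p m).2 (fs (p m).1) f)).
- by move=> m; apply: bounded_mfunZ; exact: bounded_mfun_discrepancy.
- by move=> m f; rewrite mulr_ge0 ?discrepancy_ge0// invr_ge0 energy_ge0.
- by move=> m; have [] := Hp m.
Qed.

End moments.

(** * Limits along an ultrafilter *)

Section ultralimit.
Context {R : realType}.
Variable U : set_system nat.
Hypothesis U_ultra : UltraFilter U.

(** By compactness of [-B, B] the image filter has a cluster point, and a cluster point of an
    ultrafilter is a limit. One ultrafilter thus provides limits for all test functions at once. *)
Lemma ultra_bounded_cvg (u : nat -> R) (B : R) : (forall m, `|u m| <= B) ->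
  exists l : R, u @ U --> l.
Proof.
move=> uB; have U_proper : ProperFilter U by exact: ultra_proper.
have FB : (u @ U) [set x | x \in `[- B, B]].
  by rewrite /= /fmap/=; apply: filterE => m; rewrite /= in_itv/= -ler_norml.
have [l [_ cl]] := @segment_compact R (- B) B (u @ U) _ FB.
exists l => A lA; have [//|UnA] := in_ultra_setVsetC (u @^-1` A) U_ultra.
have uUnA : (u @ U) (~` A) by exact: UnA.
by have [x [nAx Ax]] := cl _ _ uUnA lA.
Qed.

End ultralimit.

(** * The limit of the energy distributions *)

Section limit_measure.
Context {R : realType} {M : pmetricType R}.
Hypothesis M_compact : compact [set: M].
Variables (alpha : R) (fs : nat -> seq (M -> R)).
Hypothesis alpha_gt0 : 0 < alpha.
Hypothesis fs_nice : forall T phi, phi \in fs T ->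
  continuous phi /\ forall x, 0 <= phi x.
Hypothesis fs_upper : forall d : R, 0 < d -> exists C : R, 0 <= C /\
  forall T x y, feature_kernel (fs T) x y <= (1 + d) * log_cutoff T x y `^ alpha + C.
Hypothesis fs_lower : forall d : R, 0 < d -> exists C : R, 0 <= C /\
  forall T x y, log_cutoff T x y `^ alpha <= (1 + d) * feature_kernel (fs T) x y + C.
Variables (T : nat -> nat) (nu : nat -> probability (borelType M) R).

Let E m := energy (nu m) (fs (T m)).

Hypothesis E_gt : forall m, m.+1%:R < E m.

Let E_gt0 m : 0 < E m.
Proof. exact: lt_trans (E_gt m). Qed.

Let energy_share m (psi : M -> R) : R :=
  (E m)^-1 * localized_energy (nu m) (fs (T m)) psi.

Let energy_share_cst m (c : R) : energy_share m (cst c) = c.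
Proof.
rewrite /energy_share /localized_energy big_seq.
under eq_bigr => phi phi_fs.
  rewrite meanZ; last first.
    by apply: continuous_bounded_mfun => //; have [] := fs_nice phi_fs.
  rewrite -mulrA -expr2; over.
by rewrite -big_seq -mulr_sumr -/(energy _ _) mulrCA mulVf ?mulr1 ?gt_eqF// E_gt0.
Qed.

Let bounded_product m (psi phi : M -> R) : continuous psi -> phi \in fs (T m) ->
  bounded_mfun ((fun x => psi x * phi x) : borelType M -> R).
Proof.
move=> pc /fs_nice[phic _]; apply: continuous_bounded_mfun => //.
exact: continuous_mul.
Qed.

Let energy_share_le m (psi1 psi2 : M -> R) : continuous psi1 -> continuous psi2 ->
  (forall x, psi1 x <= psi2 x) -> energy_share m psi1 <= energy_share m psi2.
Proof.
move=> c1 c2 le; rewrite ler_wpM2l ?invr_ge0 ?(ltW (E_gt0 m))//.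
rewrite /localized_energy big_seq [leRHS]big_seq; apply: ler_sum => phi phi_fs.
have [phic phi0] := fs_nice phi_fs.
rewrite ler_wpM2r ?mean_ge0//; apply: mean_le;
  [exact: (bounded_product c1 phi_fs)|exact: (bounded_product c2 phi_fs)|].
by move=> x; rewrite ler_wpM2r.
Qed.

Let energy_shareD m (psi1 psi2 : M -> R) : continuous psi1 -> continuous psi2 ->
  energy_share m (fun x => psi1 x + psi2 x) = energy_share m psi1 + energy_share m psi2.
Proof.
move=> c1 c2; rewrite /energy_share -mulrDr; congr (_ * _).
rewrite /localized_energy -big_split/= big_seq [RHS]big_seq.
apply: eq_bigr => phi phi_fs; rewrite -mulrDl; congr (_ * _).
rewrite -meanD; [|exact: (bounded_product c1 phi_fs)|exact: (bounded_product c2 phi_fs)].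
by congr mean; apply/funext => x; rewrite mulrDl.
Qed.

Let energy_share_bounded (psi : M -> R) : continuous psi ->
  exists B : R, forall m, `|energy_share m psi| <= B.
Proof.
move=> pc; have [B [_ HB]] := continuous_bounded M_compact pc.
have Bpsi x : - B <= psi x <= B by rewrite -ler_norml.
exists B => m; rewrite ler_norml; apply/andP; split.
- rewrite -[leLHS](energy_share_cst m); apply: energy_share_le => //.
    exact: cst_continuous.
  by move=> x; have /andP[] := Bpsi x.
- rewrite -[leRHS](energy_share_cst m); apply: energy_share_le => //.
    exact: cst_continuous.
  by move=> x; have /andP[] := Bpsi x.
Qed.

(** The ultrafilter, hence m, is fixed before f, so one measure serves every f with negligible
    discrepancy. For such f, [localized_energy_stable] divided by the energy leaves at most an
    arbitrary e in the limit, which gives L (psi \o f) = L psi. *)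
Lemma limit_invariant_measure : exists m : probability (borelType M) R,
  forall f : lipHomeo M,
    (fun k => (E k)^-1 * discrepancy (nu k) (fs (T k)) f) @ \oo --> 0 ->
    forall B, m (f @^-1` B) = m B.
Proof.
have [U [U_ultra sub]] := ultraFilterLemma (eventually_filter : ProperFilter \oo).
have U_proper : ProperFilter U by exact: ultra_proper.
have along_U (u : nat -> R) (l : R) : u @ \oo --> l -> u @ U --> l.
  by move=> ul A /ul; exact: sub.
pose L (psi : M -> R) : R := lim (energy_share ^~ psi @ U).
have L_cvg psi : continuous psi -> energy_share ^~ psi @ U --> L psi.
  move=> /energy_share_bounded[B /(ultra_bounded_cvg U_ultra)[l hl]].
  by rewrite /L (cvg_lim _ hl).
have L_cst c : L (cst c) = c.
  rewrite /L (_ : energy_share ^~ (cst c) = fun=> c); last by apply/funext => m.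
  exact: lim_cst.
have L_le psi1 psi2 : continuous psi1 -> continuous psi2 ->
    (forall x, psi1 x <= psi2 x) -> L psi1 <= L psi2.
  move=> c1 c2 le; apply: ler_cvg_to (L_cvg _ c1) (L_cvg _ c2) _.
  by apply: filterE => m; exact: energy_share_le.
have L_add psi1 psi2 : continuous psi1 -> continuous psi2 ->
    L (fun x => psi1 x + psi2 x) = L psi1 + L psi2.
  move=> c1 c2; apply: cvg_lim => //.
  rewrite (_ : energy_share ^~ _ = fun m => energy_share m psi1 + energy_share m psi2).
    by apply: cvgD; exact: L_cvg.
  by apply/funext => m; exact: energy_shareD.
have [m Hm] := riesz_invariant M_compact L_cst L_le L_add.
exists m => f disc0; apply: (Hm f (lip_inv f)).
- exact: lipHomeo_continuous.
- exact: lip_inv_continuous.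
- exact: lip_funK.
- exact: lip_invK.
move=> psi pc psi01; have pfc := continuous_comp_lip (f := f) pc.
apply/eqP; rewrite -subr_eq0 -normr_le0; apply/ler_addgt0Pr => e e0; rewrite add0r.
have [C [C0 HC]] := localized_energy_stable M_compact alpha_gt0 fs_nice fs_upper
  fs_lower f pc psi01 e0.
have E_inv : (fun k => (E k)^-1) @ \oo --> 0.
  apply: (squeeze_cvgr _ (cvg_cst 0) cvg_harmonic); apply: nearW => k.
  by rewrite invr_ge0 (ltW (E_gt0 k))/= lef_pV2 ?posrE ?E_gt0// ltW.
have bound_cvg : (fun k => e + C * ((E k)^-1 + (E k)^-1 * discrepancy (nu k) (fs (T k)) f))
    @ U --> e.
  rewrite -[X in _ --> X](_ : e + C * (0 + 0) = e); last by rewrite addr0 mulr0 addr0.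
  apply: cvgD; first exact: cvg_cst.
  apply: cvgM; first exact: cvg_cst.
  by apply: cvgD; apply: along_U.
apply: ler_cvg_to (cvg_norm (cvgB (L_cvg _ pfc) (L_cvg _ pc))) bound_cvg _.
apply: filterE => k; rewrite -mulrBr normrM ger0_norm ?invr_ge0 ?(ltW (E_gt0 k))//.
rewrite ler_pdivrMl// (le_trans (HC (T k) (nu k)))// le_eqVlt; apply/orP; left; apply/eqP.
by rewrite -/(E k); field; rewrite gt_eqF.
Qed.

End limit_measure.

(** * From bounded energy to log-Hölder regularity *)

Section energy_bound.
Context {R : realType} {M : pmetricType R}.
Hypothesis M_compact : compact [set: M].
Variables (alpha : R) (fs : nat -> seq (M -> R)).
Hypothesis alpha_gt0 : 0 < alpha.
Hypothesis fs_nice : forall T phi, phi \in fs T ->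
  continuous phi /\ forall x, 0 <= phi x.
Hypothesis fs_upper : forall d : R, 0 < d -> exists C : R, 0 <= C /\
  forall T x y, feature_kernel (fs T) x y <= (1 + d) * log_cutoff T x y `^ alpha + C.
Hypothesis fs_lower : forall d : R, 0 < d -> exists C : R, 0 <= C /\
  forall T x y, log_cutoff T x y `^ alpha <= (1 + d) * feature_kernel (fs T) x y + C.
Variable mu : probability (borelType (lipHomeo M)) R.
Hypothesis mu_moment :
  (\int[mu]_f ((ln (lip_const (f : lipHomeo M))) `^ alpha)%:E < +oo)%E.
Hypothesis mu_no_invariant :
  ~ exists m : probability (borelType M) R, ae_invariant mu m.

Lemma stationary_energy_bounded : exists C : R,
  forall T (nu : probability (borelType M) R), stationary mu nu ->
  energy nu (fs T) <= C.
Proof.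
apply: contrapT => nb; apply: mu_no_invariant.
have unbounded (C : R) : exists T (nu : probability (borelType M) R),
    stationary mu nu /\ C < energy nu (fs T).
  apply: contrapT => no; apply: nb; exists C => T nu st.
  by rewrite leNgt; apply/negP => CE; apply: no; exists T, nu.
have [T [nu [E_gt ae0]]] := unbounded_energy_sequence M_compact alpha_gt0 fs_nice
  fs_upper fs_lower mu_moment unbounded.
have [m Hm] := limit_invariant_measure M_compact alpha_gt0 fs_nice fs_upper fs_lower E_gt.
exists m; move: ae0; apply: (@filterS _ (almost_everywhere mu)) => f f0 B _; exact: Hm.
Qed.

Lemma stationary_log_holder : exists C : R,
  forall nu : probability (borelType M) R,
  stationary mu nu -> log_holder C (alpha / 2) nu.
Proof.
have [C HC] := stationary_energy_bounded.
have [K [K0 HK]] := log_ball_lower alpha_gt0 fs_nice fs_lower.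
exists (Num.sqrt (K * C + K)) => nu st x r /andP[r0 r1].
have lnr : 0 < `|ln r| by rewrite normr_gt0 lt_eqF// ln_lt0// r0.
(* T depends on r, so that the truncation leaves the scale r visible; this is why the energy bound
   has to be uniform in T. *)
pose T := (Num.truncn `|ln r|).+1; have rT : `|ln r| <= T%:R by rewrite ltW// truncnS_gt.
have mB : measurable (ball x r : set (borelType M)).
  apply: sub_sigma_algebra.
  rewrite (_ : ball x r = (fun y => mdist y x) @^-1` [set s | s < r]).
    by apply: open_comp => [y _|]; [exact: mdist_continuous|exact: open_lt].
  by rewrite ballEmdist; apply/seteqP; split => y /=; rewrite metric_sym.
set p := fine (nu (ball x r)).
have p0 : 0 <= p by rewrite fine_ge0.
have key : `|ln r| `^ alpha * p ^+ 2 <= K * C + K.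
  have bind : bounded_mfun (\1_(ball x r) : borelType M -> R) by exact: bounded_mfun_indic.
  (* The rank-one kernel |ln r|^alpha 1_B(y) 1_B(z) is compared with K k_T(y, z) + K; its double
     integral is |ln r|^alpha nu(B)^2. *)
  have := @rank_form_le _ (borelType M) R nu
    [:: ((fun y => `|ln r| `^ alpha * \1_(ball x r) y), \1_(ball x r))]
    ([seq ((fun y => K * phi y), phi) | phi <- fs T] ++ [:: ((fun=> K), (fun=> 1))]).
  rewrite /rank_form /rank_kernel big_seq1/= meanZ// mean_indic// -/p -mulrA -expr2.
  rewrite big_cat/= big_map big_seq1/= !mean_cst mulr1.
  have -> : \sum_(phi <- fs T) mean nu (fun y => K * phi y) * mean nu phi =
      K * energy nu (fs T).
    rewrite /energy mulr_sumr big_seq [RHS]big_seq; apply: eq_bigr => phi /fs_nice[pc _].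
    by rewrite meanZ; [rewrite -mulrA|exact: continuous_bounded_mfun].
  move=> le; apply: le_trans (le _ _ _) _.
  - by move=> q; rewrite inE => /eqP ->; split => //; exact: bounded_mfunZ.
  - move=> q; rewrite mem_cat => /orP[/mapP[phi /fs_nice[pc _] ->]|].
      by split; [apply: bounded_mfunZ|]; exact: continuous_bounded_mfun.
    by rewrite inE => /eqP ->; split; exact: bounded_mfun_cst.
  - move=> y z; rewrite big_seq1/= big_cat/= big_map big_seq1/= mulr1.
    have -> : \sum_(phi <- fs T) K * phi y * phi z = K * feature_kernel (fs T) y z.
      by rewrite /feature_kernel mulr_sumr; apply: eq_bigr => phi _; rewrite mulrA.
    have k0 : 0 <= K * feature_kernel (fs T) y z + K.
      by rewrite addr_ge0// mulr_ge0// (kernel_ge0 fs_nice).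
    rewrite !indicE.
    have [yB|_] := boolP (y \in (ball x r : set (borelType M))); last first.
      by rewrite mulr0 mul0r.
    have [zB|_] := boolP (z \in (ball x r : set (borelType M))); last by rewrite mulr0.
    rewrite !mulr1; apply: HK => //; first by rewrite r0.
    move: yB zB; rewrite !inE ballEmdist/= => xy xz.
    rewrite (le_trans (metric_triangle y x z))// (metric_sym y x).
    by rewrite mulr2n mulrDl !mul1r ltW// ltrD.
  - by rewrite lerD2r ler_wpM2l// HC.
have KC0 : 0 <= K * C + K by apply: le_trans key; rewrite mulr_ge0 ?powR_ge0 ?sqr_ge0.
rewrite -(fineK (fin_num_measure nu _ mB)) lee_fin -/p.
have a0 : 0 < `|ln r| `^ (alpha / 2) by exact: powR_gt0.
rewrite powRN ler_pdivlMr// -(ger0_norm (mulr_ge0 p0 (ltW a0))) -sqrtr_sqr.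
apply: ler_wsqrtr; apply: le_trans key.
rewrite exprMn mulrC ler_wpM2r ?sqr_ge0// -powR_mulrn ?powR_ge0// -powRrM.
by rewrite divfK.
Qed.

End energy_bound.

Theorem theorem1p1p2 (R : realType) (n : nat) (M : pmetricType R)
    (A : smoothAtlas R n M) (g : riemannianMetric A)
    (M_compact : compact [set: M]) (M_connected : connected [set: M])
    (M_dist : forall x y : M, mdist x y = riemannian_distance g x y)
    (mu : probability (borelType (lipHomeo M)) R) (alpha : R)
    (alpha_gt0 : 0 < alpha)
    (mu_moment :
      (\int[mu]_f ((ln (lip_const (f : lipHomeo M))) `^ alpha)%:E < +oo)%E)
    (mu_no_invariant :
      ~ exists m : probability (borelType M) R, ae_invariant mu m) :
  exists C : R, forall nu : probability (borelType M) R,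
    stationary mu nu -> log_holder C (alpha / 2) nu.
Proof.
have [D [D0 cover]] := exponential_covering M_compact M_dist.
have /choice[net netP] := cover.
have net_size j : (size (net j))%:R <= expR (D * j.+1%:R) by have [] := netP j.
have net_dense j x : exists2 y, y \in net j & mdist x y <= expR (- j%:R).
  by have [_] := netP j; exact.
apply: (@stationary_log_holder R M M_compact alpha (log_family alpha D net)) => //.
- exact: log_family_continuous_ge0.
- exact: log_family_upper.
- exact: log_family_lower.
Qed.
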